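(* The map ${}'\epsilon:\mathcal X_{N-2}\to E_N$ induces bijections $\mathcal X^+_{N-2}\to E_N^+$ and $\mathcal X^-_{N-2}\to E_N^-$; moreover, for every even integer $t$ it induces a bijection $\mathcal X^{t,+}_{N-2}\to E_N^{t,+}$ and a bijection $\mathcal X^{t,-}_{N-2}\to E_N^{t,-}$.
   Context: Let $N\ge 3$ be an odd integer and $F=\mathbb Z/2\mathbb Z$. For integers $i,j$ let $[i,j]=\{h\in\mathbb Z: i\le h\le j\}$ (empty if $i>j$). Let $S_N=[1,N]$. The set of all subsets of $S_N$ is an $F$-vector space with sum $X+X'=(X\cup X')-(X\cap X')$; let $E_N$ be the subspace of subsets of even cardinality. A $2$-element subset $\{i,j\}\subseteq S_N$ is written $ij$ when either ($i<j$ and $j-i$ odd) or ($i>j$ and $i-j$ even); each $2$-element subset has exactly one such writing. Let $\mathcal P_N$ be the set of all finite sets $B$ of pairwise disjoint $2$-element subsets of $S_N$; for $B\in\mathcal P_N$ let $\mathrm{supp}(B)=\bigcup_{X\in B}X$, $B^0=\{\{i,j\}\in B: i-j\text{ even}\}$, $B^1=\{\{i,j\}\in B: i-j\text{ odd}\}$. A set $X\subseteq S_N$ is $0$-covered (resp. $1$-covered) by $B^1$ if there are $a_1b_1,\dots,a_sb_s\in B^1$ ($s\ge 0$, so $a_r<b_r$) with $X=[a_1,b_1]\sqcup\dots\sqcup[a_s,b_s]$ (resp. $X=[a_1,b_1]\sqcup\dots\sqcup[a_s,b_s]\sqcup\{u\}$ for some $u$), disjoint unions. Let ${}^*\mathcal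 P_N$ be the set of $B\in\mathcal P_N$ such that: for every $ij\in B^1$ the set $[i+1,j-1]$ is $0$-covered by $B^1$; and there is a sequence $i_*(B)=(i_1,\dots,i_{2s})$ in $S_N$ with $B^0=\{i_{2s}i_1,i_{2s-1}i_2,\dots,i_{s+1}i_s\}$ (so $s=|B^0|$; the sequence is unique) such that, if $s\ge1$, each of $[i_1+1,i_2-1],\dots,[i_{s-1}+1,i_s-1],[i_{s+1}+1,i_{s+2}-1],\dots,[i_{2s-1}+1,i_{2s}-1]$ is $0$-covered by $B^1$. For $B\in{}^*\mathcal P_N$ with $i_*(B)=(i_1,\dots,i_{2s})$ consider: (I) $s=0$, or $s\ge1$ and $[1,i_1-1]$ and $[i_{2s}+1,N]$ are $0$-covered by $B^1$; (II) $N\notin\mathrm{supp}(B)$ and either $s=0$, or $s$ is odd and either (i) $[1,i_1-1]$ is $1$-covered and $[i_{2s}+1,N-1]$ is $0$-covered by $B^1$, or (ii) $[1,i_1-1]$ is $0$-covered and $[i_{2s}+1,N-1]$ is $1$-covered by $B^1$; (III) (I) holds and, if $s$ is even then $\{i,N\}\in B$ for some even $i$, if $s$ is odd then $\{i,N\}\in B$ for some odd $i$. Let $\mathcal X^+_{N-2}$, $\mathcal X^-_{N-2}$ be the sets of $B\in{}^*\mathcal P_N$ satisfying (II), (III) respectively, and $\mathcal X_{N-2}=\mathcal X^+_{N-2}\sqcup\mathcal X^-_{N-2}$. For $B\in\mathcal X^+_{N-2}$ with $s\ge1$ there is a unique $u_B$: in case (i), $u_B\in[1,i_1-1]$ with $[1,u_B-1]$,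 $[u_B+1,i_1-1]$ $0$-covered by $B^1$ ($u_B$ odd); in case (ii), $u_B\in[i_{2s}+1,N-1]$ with $[i_{2s}+1,u_B-1]$, $[u_B+1,N-1]$ $0$-covered by $B^1$ ($u_B$ even). For even $t$: $\mathcal X^{0,+}_{N-2}=\{B\in\mathcal X^+_{N-2}:|B^0|=0\}$; for $t\ge2$, $\mathcal X^{t,+}_{N-2}=\{B\in\mathcal X^+_{N-2}:|B^0|=t-1,\ u_B\text{ odd}\}$; for $t\le-2$, $\mathcal X^{t,+}_{N-2}=\{B\in\mathcal X^+_{N-2}:|B^0|=-t-1,\ u_B\text{ even}\}$; $\mathcal X^{0,-}_{N-2}=\{B\in\mathcal X^-_{N-2}:|B^0|=0\}$; for $t\ge2$, $\mathcal X^{t,-}_{N-2}=\{B\in\mathcal X^-_{N-2}:|B^0|=t,\ \{i,N\}\in B\text{ for some even }i\}$; for $t\le -2$, $\mathcal X^{t,-}_{N-2}=\{B\in\mathcal X^-_{N-2}:|B^0|=-t-1,\ \{i,N\}\in B\text{ for some odd }i\}$. Put $[[ij]]=[i,j]$ if $i<j$ and $[[ij]]=[i,N]\cup[1,j]$ if $i>j$. For $B\in\mathcal X_{N-2}$ define ${}'\epsilon(B)\in E_N$: ${}'\epsilon(B)=\sum_{ij\in B}[[ij]]$ if $B\in\mathcal X^-_{N-2}$ or if $B\in\mathcal X^+_{N-2}$ with $|B^0|=0$; ${}'\epsilon(B)=\sum_{ij\in B}[[ij]]+[u_B,N]$ if $B\in\mathcal X^+_{N-2}$, $|B^0|$ odd,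 $u_B$ even; ${}'\epsilon(B)=\sum_{ij\in B}[[ij]]+\{N\}+[1,u_B]$ if $B\in\mathcal X^+_{N-2}$, $|B^0|$ odd, $u_B$ odd. For $X\in E_N$ let $\gamma(X)=|\{x\in X: x\text{ even}\}|-|\{x\in X:x\text{ odd}\}|$. Let $E_N^+=\{X\in E_N:N\notin X\}$, $E_N^-=\{X\in E_N:N\in X\}$, and for even $t$ let $E_N^{t,\pm}=\{X\in E_N^{\pm}:\gamma(X)=t\}$. *)

(* Defs.v *)
(* Elements of S_N = [1,N] are represented by ordinals
   x : 'I_N.+1 with 0 < x (the value 0 is never used); subsets of S_N are
   finite sets {set 'I_N.+1} avoiding 0; an element B of P_N is a finite set
   of 2-element sets, B : {set {set 'I_N.+1}}. *)
From mathcomp Require Import all_boot all_order all_algebra.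
Set Implicit Arguments. Unset Strict Implicit. Unset Printing Implicit Defensive.
Import Order.TTheory GRing.Theory Num.Theory.

Definition itv (N i j : nat) : {set 'I_N.+1} := [set x : 'I_N.+1 | i <= x <= j].

(* the sum X + X' = (X u X') - (X n X') in the F_2-vector space of subsets *)
Definition symd (T : finType) (A B : {set T}) : {set T} := (A :\: B) :|: (B :\: A).

(* the pair {i,j} is written "ij" *)
Definition wr (i j : nat) : bool :=
  ((i < j) && odd (j - i)) || ((j < i) && ~~ odd (i - j)).

Definition inS (N : nat) (X : {set 'I_N.+1}) : bool := [forall x in X, 0 < x].

Definition inP (N : nat) (B : {set {set 'I_N.+1}}) : bool :=
  [forall P in B, (#|P| == 2) && inS P] &&
  [forall P in B, forall Q in B, (P != Q) ==> [disjoint P & Q]].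

Definition supp (N : nat) (B : {set {set 'I_N.+1}}) : {set 'I_N.+1} :=
  \bigcup_(P in B) P.

Definition B0 (N : nat) (B : {set {set 'I_N.+1}}) : {set {set 'I_N.+1}} :=
  [set P in B | [forall x in P, forall y in P, odd x == odd y]].
Definition B1 (N : nat) (B : {set {set 'I_N.+1}}) : {set {set 'I_N.+1}} :=
  B :\: B0 B.

Definition ivl (N : nat) (P : {set 'I_N.+1}) : {set 'I_N.+1} :=
  [set x : 'I_N.+1 | [exists a in P, exists b in P, a <= x <= b]].

Definition covered0 (N : nat) (B : {set {set 'I_N.+1}}) (X : {set 'I_N.+1}) : bool :=
  [exists C : {set {set 'I_N.+1}},
    [&& C \subset B1 B,
        X == \bigcup_(P in C) ivl P &
        [forall P in C, forall Q in C, (P != Q) ==> [disjoint ivl P & ivl Q]]]].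

Definition covered1 (N : nat) (B : {set {set 'I_N.+1}}) (X : {set 'I_N.+1}) : bool :=
  [exists u in X, covered0 B (X :\ u)].

Definition sB (N : nat) (B : {set {set 'I_N.+1}}) : nat := #|B0 B|.

(* a candidate sequence (i_1, ..., i_{2s}), given as a finite function on
   indices 0..2s-1 *)
Definition iseq (N : nat) (B : {set {set 'I_N.+1}})
  (f : {ffun 'I_(2 * sB B) -> 'I_N.+1}) : seq nat :=
  [seq val (f k) | k <- enum 'I_(2 * sB B)].

(* the conditions on i_*(B); i_k = nth 0 sq k.-1 *)
Definition starseq (N : nat) (B : {set {set 'I_N.+1}})
  (f : {ffun 'I_(2 * sB B) -> 'I_N.+1}) : bool :=
  let s := sB B in
  let sq := iseq f in
  let ie := fun k => nth 0 sq k.-1 in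
  [&& sorted ltn sq,
      B0 B == [set [set (inord (ie (2 * s - k)) : 'I_N.+1); inord (ie k.+1)] | k : 'I_s],
      [forall k : 'I_s, wr (ie (2 * s - k)) (ie k.+1)] &
      [forall k : 'I_(2 * s), ((k.+1 != s) && (k.+1 != 2 * s)) ==>
          covered0 B (itv N (ie k.+1).+1 (ie k.+2).-1)]].

Definition starP (N : nat) (B : {set {set 'I_N.+1}}) : bool :=
  [&& inP B,
      [forall i : 'I_N.+1, forall j : 'I_N.+1,
          (([set i; j] \in B1 B) && wr i j) ==> covered0 B (itv N i.+1 j.-1)] &
      [exists f : {ffun 'I_(2 * sB B) -> 'I_N.+1}, starseq f]].

(* the (unique) sequence i_*(B) *)
Definition istar (N : nat) (B : {set {set 'I_N.+1}}) : seq nat :=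
  if [pick f : {ffun 'I_(2 * sB B) -> 'I_N.+1} | starseq f] is Some f
  then iseq f else [::].

Definition iS (N : nat) (B : {set {set 'I_N.+1}}) (k : nat) : nat :=
  nth 0 (istar B) k.-1.

Definition condI (N : nat) (B : {set {set 'I_N.+1}}) : bool :=
  (sB B == 0) ||
  (covered0 B (itv N 1 (iS B 1).-1) && covered0 B (itv N (iS B (2 * sB B)).+1 N)).

Definition caseI (N : nat) (B : {set {set 'I_N.+1}}) : bool :=
  covered1 B (itv N 1 (iS B 1).-1) && covered0 B (itv N (iS B (2 * sB B)).+1 N.-1).
Definition caseII (N : nat) (B : {set {set 'I_N.+1}}) : bool :=
  covered0 B (itv N 1 (iS B 1).-1) && covered1 B (itv N (iS B (2 * sB B)).+1 N.-1).

Definition condII (N : nat) (B : {set {set 'I_N.+1}}) : bool :=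
  (ord_max \notin supp B) &&
  ((sB B == 0) || (odd (sB B) && (caseI B || caseII B))).

Definition hasNpair (N : nat) (B : {set {set 'I_N.+1}}) (p : bool) : bool :=
  [exists i : 'I_N.+1, (odd i == p) && ([set i; ord_max] \in B)].

Definition condIII (N : nat) (B : {set {set 'I_N.+1}}) : bool :=
  condI B && (if odd (sB B) then hasNpair B true else hasNpair B false).

Definition inXp (N : nat) (B : {set {set 'I_N.+1}}) : bool := starP B && condII B.
Definition inXm (N : nat) (B : {set {set 'I_N.+1}}) : bool := starP B && condIII B.

Definition ucond (N : nat) (B : {set {set 'I_N.+1}}) (u : nat) : bool :=
  [&& caseI B, 1 <= u <= (iS B 1).-1, covered0 B (itv N 1 u.-1) &
      covered0 B (itv N u.+1 (iS B 1).-1)] ||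
  [&& caseII B, (iS B (2 * sB B)).+1 <= u <= N.-1,
      covered0 B (itv N (iS B (2 * sB B)).+1 u.-1) &
      covered0 B (itv N u.+1 N.-1)].

Definition uB (N : nat) (B : {set {set 'I_N.+1}}) : nat :=
  if [pick u : 'I_N.+1 | ucond B u] is Some u then val u else 0.

Definition dbr (N : nat) (P : {set 'I_N.+1}) : {set 'I_N.+1} :=
  [set x : 'I_N.+1 | [exists i in P, exists j in P,
     wr i j && (if i < j then i <= x <= j else (i <= x) || (1 <= x <= j))]].

Definition epsbase (N : nat) (B : {set {set 'I_N.+1}}) : {set 'I_N.+1} :=
  \big[@symd _/set0]_(P in B) dbr P.

Definition eps (N : nat) (B : {set {set 'I_N.+1}}) : {set 'I_N.+1} :=
  if (sB B == 0) || inXm B then epsbase B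
  else if odd (uB B) then symd (symd (epsbase B) [set ord_max]) (itv N 1 (uB B))
  else symd (epsbase B) (itv N (uB B) N).

Definition inE (N : nat) (X : {set 'I_N.+1}) : bool := inS X && ~~ odd #|X|.
Definition inEp (N : nat) (X : {set 'I_N.+1}) : bool := inE X && (ord_max \notin X).
Definition inEm (N : nat) (X : {set 'I_N.+1}) : bool := inE X && (ord_max \in X).

Definition gamma (N : nat) (X : {set 'I_N.+1}) : int :=
  ((#|[set x in X | ~~ odd x]|)%:Z - (#|[set x in X | odd x]|)%:Z)%R.

Definition Etp (N : nat) (t : int) (X : {set 'I_N.+1}) : bool := inEp X && (gamma X == t).
Definition Etm (N : nat) (t : int) (X : {set 'I_N.+1}) : bool := inEm X && (gamma X == t).

Definition Xtp (N : nat) (t : int) (B : {set {set 'I_N.+1}}) : bool :=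
  inXp B &&
  (if t == 0%R then sB B == 0
   else if (0 < t)%R then (sB B == (absz t).-1) && odd (uB B)
   else (sB B == (absz t).-1) && ~~ odd (uB B)).

Definition Xtm (N : nat) (t : int) (B : {set {set 'I_N.+1}}) : bool :=
  inXm B &&
  (if t == 0%R then sB B == 0
   else if (0 < t)%R then (sB B == absz t) && hasNpair B false
   else (sB B == (absz t).-1) && hasNpair B true).

Definition bijOn (T U : Type) (A : T -> bool) (E : U -> bool) (f : T -> U) : Prop :=
  [/\ forall x, A x -> E (f x),
      forall x y, A x -> A y -> f x = f y -> x = y &
      forall z, E z -> exists2 x, A x & f x = z].

(* Main.v *)
(* Read the odd pairs ij of B as arcs i < j, and the even pairs (written ij with
   i > j) as arcs that start at i, run through N and end at j; the matching is
   then noncrossing on a circle.  Let d(x) be the number of arcs over the gap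
   between x and x+1 (0 <= x <= N), so d(0) = d(N) = |B^0|.  If B satisfies (I),
   unmatched points lie under no arc, and with b(x) the indicator of 'eps(B) the
   depth obeys d(x) = d(x-1) - 1 (0 if d(x-1) = 0) when d(x-1) has the parity of
   b(x), and d(x) = d(x-1) + 1 otherwise.  Under the bijection psi : nat -> Z,
   psi(2k) = k, psi(2k+1) = -k-1, each such step is the reflection
   z |-> -b(x) - z.  As N is odd, the closing condition d(0) = d(N) amounts to
   2 psi(|B^0|) = gamma('eps(B)); hence the set 'eps(B) determines |B^0|, then d,
   then B (an opener is matched with the next closer at its level), and every
   even set arises.  So B |-> sum [[ij]] is a bijection from {B : (I)} to E_N.
   Moreover N lies in 'eps(B) exactly when (III) holds, which settles X^-; and a
   B in X^+ with s >= 1 becomes a matching with (I) and the same 'eps once the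
   pair {u_B, N} is added, which settles X^+. *)
Require Import Defs.
From mathcomp Require Import all_boot all_order all_algebra.
From mathcomp Require Import zify.
Set Implicit Arguments. Unset Strict Implicit. Unset Printing Implicit Defensive.

(** * Pairs and depth *)

(** Parity ties a pair to the route of its arc. At a matched point depth and position both change by
    one, and a flat step needs depth 0 on both sides; so two gaps of equal depth with no flat step
    between them are an even distance apart. An opener and the closer at its level thus form an odd
    pair if the arc avoids N, and an even pair if it passes N, since N is odd. The same count over
    all of [0,N] shows that some step is flat: the profile reaches 0, so the depth of the
    reconstructed matching is determined exactly and not only up to a constant. The other obstacle
    is that the definitions speak of disjoint unions of intervals. These are replaced by conditions
    on points: a set is 0-covered when each of its points is an endpoint of an odd pair whose
    interval stays in the set. *)

(* Points are naturals, embedded by inord, so that lia applies. *)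
Definition paired N (B : {set {set 'I_N.+1}}) (i j : nat) : bool :=
  [&& i < j, j <= N & [set inord i; inord j] \in B].

Lemma val_inord N x : x <= N -> val (inord x : 'I_N.+1) = x.
Proof. by move=> xN; rewrite /= inordK. Qed.

Lemma inord_eq N x y : x <= N -> y <= N -> (inord x == inord y :> 'I_N.+1) = (x == y).
Proof. by move=> xN yN; rewrite -val_eqE !val_inord. Qed.

Lemma mem_inord2 N i j (x : 'I_N.+1) : i <= N -> j <= N ->
  (x \in [set inord i; inord j]) = (x == i :> nat) || (x == j :> nat).
Proof. by move=> iN jN; rewrite !inE -!val_eqE !val_inord. Qed.

Lemma paired_lt N (B : {set {set 'I_N.+1}}) i j : paired B i j -> i < j <= N.
Proof. by case/and3P=> -> ->. Qed.

Lemma inP_card N (B : {set {set 'I_N.+1}}) P : inP B -> P \in B ->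
  exists i j, [/\ paired B i j, 0 < i & P = [set inord i; inord j]].
Proof.
case/andP=> /forallP h _ PB; have /implyP /(_ PB) /andP[/cards2P[x [y [xy defP]]]] := h P.
move/forallP=> P0.
have pos z : z \in P -> 0 < z by move=> zP; move: (P0 z); rewrite zP.
have ltxy (a b : 'I_N.+1) : a < b -> P = [set a; b] ->
  exists i j, [/\ paired B i j, 0 < i & P = [set inord i; inord j]].
  move=> ab Pab; exists a, b; rewrite /paired !inord_val -Pab; split=> //.
    by rewrite ab PB -ltnS ltn_ord.
  by apply: pos; rewrite Pab !inE eqxx.
have: x != y :> nat by rewrite (inj_eq val_inj).
by rewrite neq_ltn => /orP[] lt; apply: (ltxy _ _ lt) => //; rewrite setUC.
Qed.

Lemma inP_disj N (B : {set {set 'I_N.+1}}) P Q x :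
  inP B -> P \in B -> Q \in B -> x \in P -> x \in Q -> P = Q.
Proof.
case/andP=> _ /forallP/(_ P)/implyP h PB QB xP xQ; apply/eqP.
move/(_ PB)/forallP/(_ Q)/implyP/(_ QB)/implyP: h; case: eqP => // _ /(_ isT).
by rewrite disjoint_subset => /subsetP/(_ _ xP); rewrite inE xQ.
Qed.

Lemma paired_gt0 N (B : {set {set 'I_N.+1}}) i j : inP B -> paired B i j -> 0 < i.
Proof.
move=> BP /and3P[ij jN /(inP_card BP)[k [l [kl k0 /setP eqs]]]].
have iN : i <= N by lia.
have := eqs (inord i); rewrite set21 mem_inord2 ?inordK //; last by case/and3P: kl.
  by case/and3P: kl => kl lN _; lia.
by case/and3P: kl => kl lN _; lia.
Qed.

Lemma set2_inord_inj N i j k l : i < j <= N -> k < l <= N ->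
  [set inord i; inord j] = [set inord k; inord l] :> {set 'I_N.+1} -> i = k /\ j = l.
Proof.
move=> ij kl /setP eqs.
have h x : x <= N -> (x == i) || (x == j) = ((x == k) || (x == l)).
  by move=> xN; have := eqs (inord x); rewrite !mem_inord2 ?inordK; lia.
by have := h i; have := h j; have := h k; have := h l; lia.
Qed.

Lemma paired_disj N (B : {set {set 'I_N.+1}}) i j k l : inP B -> paired B i j -> paired B k l ->
  (i = k /\ j = l) \/ (i <> k /\ i <> l /\ j <> k /\ j <> l).
Proof.
move=> BP pij pkl.
have [lij lkl] := (paired_lt pij, paired_lt pkl).
have /and3P[_ _ Pij] := pij; have /and3P[_ _ Pkl] := pkl.
have meet x : x <= N -> (x == i) || (x == j) -> (x == k) || (x == l) -> i = k /\ j = l.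
  move=> xN xij xkl; apply: (@set2_inord_inj N) => //.
  by apply: (inP_disj BP Pij Pkl (x := inord x)); rewrite mem_inord2 ?inordK; lia.
have := meet i; have := meet j; lia.
Qed.

Definition matched N (B : {set {set 'I_N.+1}}) (x : nat) : Prop :=
  exists y, paired B x y \/ paired B y x.

Lemma paired_matched N (B : {set {set 'I_N.+1}}) i j : paired B i j -> matched B i /\ matched B j.
Proof. by move=> pij; split; [exists j; left | exists i; right]. Qed.

Lemma suppP N (B : {set {set 'I_N.+1}}) x : inP B -> x <= N ->
  reflect (matched B x) (inord x \in supp B).
Proof.
move=> BP xN; apply: (iffP bigcupP) => [[P PB]|[y [/[dup] pxy|/[dup] pyx]]].
- have [i [j [pij _ ->]]] := inP_card BP PB; have := paired_lt pij => ij.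
  rewrite mem_inord2 ?inordK //; try lia.
  by case/orP=> /eqP ->; apply paired_matched in pij; case: pij.
- by case/and3P=> _ _ PB; exists [set inord x; inord y]; rewrite // !inE eqxx.
by case/and3P=> _ _ PB; exists [set inord y; inord x]; rewrite // !inE eqxx orbT.
Qed.

Lemma matched_dec N (B : {set {set 'I_N.+1}}) x : inP B -> x <= N -> matched B x \/ ~ matched B x.
Proof. by move=> BP xN; case: (suppP BP xN); [left | right]. Qed.

Lemma mem_B0 N (B : {set {set 'I_N.+1}}) i j : i < j <= N ->
  ([set inord i; inord j] \in B0 B) = paired B i j && ~~ odd (i + j).
Proof.
move=> ij; rewrite inE /paired; have /andP[-> ->] /= := ij; case: (_ \in B) => //=.
apply/forallP/idP => [h|ev x].
  have := h (inord i); rewrite set21 => /forallP/(_ (inord j)).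
  by rewrite set22 //= !inordK //; lia.
apply/implyP; rewrite mem_inord2; try lia; move=> xij.
by apply/forallP=> y; apply/implyP; rewrite mem_inord2; lia.
Qed.

Lemma mem_B1 N (B : {set {set 'I_N.+1}}) i j : i < j <= N ->
  ([set inord i; inord j] \in B1 B) = paired B i j && odd (i + j).
Proof.
move=> ij; rewrite inE mem_B0 // /paired; have /andP[-> ->] /= := ij.
by case: (_ \in B) => //=; rewrite ?andbF // negbK andbT.
Qed.

(* The arc of the pair i < j passes over the gap between x and x+1. *)
Definition covers (i j x : nat) : bool :=
  if odd (i + j) then i <= x < j else (x < i) || (j <= x).

Definition covers_set N (P : {set 'I_N.+1}) (x : nat) : bool :=
  [exists i in P, exists j in P, (i < j) && covers i j x].

Lemma covers_setE N i j x : i < j <= N -> covers_set ([set inord i;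
  inord j] : {set 'I_N.+1}) x = covers i j x.
Proof.
move=> ij; apply/existsP/idP => [[a /andP[]]|c].
  rewrite mem_inord2; try lia; move=> aij /existsP[b /andP[]].
  rewrite mem_inord2; try lia; move=> bij /andP[ab].
  by have [-> ->] : a = i :> nat /\ b = j :> nat by lia.
exists (inord i); rewrite set21; apply/existsP; exists (inord j).
by rewrite set22 //= !inordK; lia.
Qed.

(** Here i is the smaller point, so an even pair is written [ji] and its set is [j,N] together with
    [1,i]. Positivity of x keeps away the spare ordinal 0. *)
Lemma dbrE N i j x : 0 < i -> i < j <= N -> 0 < x <= N ->
  (inord x \in dbr ([set inord i; inord j] : {set 'I_N.+1})) =
  if odd (i + j) then i <= x <= j else (x <= i) || (j <= x).
Proof.
move=> i0 ij x0; rewrite inE inordK; last lia.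
apply/existsP/idP => [[a /andP[]]|c].
  rewrite mem_inord2; try lia; move=> aij /existsP[b /andP[]].
  rewrite mem_inord2; try lia; move=> bij; rewrite /wr.
  case: ltnP => ab; case: ifP => oij /=; lia.
case o: (odd (i + j)) c => c.
  exists (inord i); rewrite set21; apply/existsP; exists (inord j).
  rewrite set22 //= !inordK /wr; try lia.
  have -> : i < j by lia.
  lia.
exists (inord j); rewrite set22 //; apply/existsP; exists (inord i).
rewrite set21 //= !inordK /wr; try lia.
have -> : j < i = false by lia.
lia.
Qed.

Definition depth N (B : {set {set 'I_N.+1}}) (x : nat) : nat := #|[set P in B | covers_set P x]|.

Lemma in_symd (T : finType) (A A' : {set T}) x : (x \in symd A A') = (x \in A) (+) (x \in A').
Proof. by rewrite !inE; case: (x \in A); case: (x \in A'). Qed.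

Lemma mem_big_symd (I T : finType) (B : {set I}) (F : I -> {set T}) x :
  (x \in \big[@symd _/set0]_(P in B) F P) = odd #|[set P in B | x \in F P]|.
Proof.
rewrite (big_morph (fun A : {set T} => x \in A) (id1 := false) (op1 := addb)); first last.
- by rewrite inE.
- by move=> A A'; rewrite in_symd.
rewrite -sum1dep_card (big_morph odd (id1 := false) (op1 := addb)) //; last exact: oddD.
rewrite [RHS]big_mkcondr; apply: eq_bigr => P _; by case: (_ \in _).
Qed.

Lemma mem_epsbase N (B : {set {set 'I_N.+1}}) x :
  (x \in epsbase B) = odd #|[set P in B | x \in dbr P]|.
Proof. exact: mem_big_symd. Qed.

Lemma depth_succ N (B : {set {set 'I_N.+1}}) i j y z : inP B -> paired B i j ->
  covers i j y -> ~~ covers i j z ->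
  (forall k l, paired B k l -> (k <> i /\ l <> j) -> covers k l y = covers k l z) ->
  depth B y = (depth B z).+1.
Proof.
move=> BP pij cy cz h; have ij := paired_lt pij; have /and3P[_ _ PB] := pij.
rewrite /depth; set P : {set 'I_N.+1} := [set inord i; inord j].
have -> : [set Q in B | covers_set Q y] = P |: [set Q in B | covers_set Q z].
  apply/setP=> Q; rewrite !inE; case: eqP => [->|neQ] /=; first by rewrite PB covers_setE.
  have [QB|//] := boolP (Q \in B); have [k [l [pkl _ defQ]]] := inP_card BP QB.
  rewrite /= defQ !covers_setE ?(paired_lt pkl) //; apply: (h _ _ pkl).
  case: (paired_disj BP pij pkl) => [[ek el]|]; last lia.
  by case: neQ; rewrite defQ -ek -el.
by rewrite cardsU1 inE covers_setE // (negPf cz) andbF.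
Qed.

(** Since [[kl]] contains both endpoints, membership of x must be read at the right neighbouring gap
    y: x at an opener or an unmatched point, x-1 at a closer. *)
Lemma epsbase_depth N (B : {set {set 'I_N.+1}}) x y : inP B -> 0 < x <= N ->
  (forall k l, paired B k l ->
     (if odd (k + l) then k <= x <= l else (x <= k) || (l <= x)) = covers k l y) ->
  (inord x \in epsbase B) = odd (depth B y).
Proof.
move=> BP xN h; rewrite mem_epsbase /depth; congr (odd #|pred_of_set _|).
apply/setP=> Q; rewrite in_set [RHS]in_set; have [QB|//] := boolP (Q \in B).
have [k [l [pkl k0 ->]]] := inP_card BP QB.
by rewrite /= dbrE ?covers_setE ?(paired_lt pkl) ?h.
Qed.

(** * Openers and closers *)

(** An even arc starts at its larger point, so the roles of the two endpoints are exchanged for even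
    pairs. *)
Definition opener N (B : {set {set 'I_N.+1}}) x : Prop :=
  exists y, (paired B x y /\ odd (x + y)) \/ (paired B y x /\ ~~ odd (y + x)).
Definition closer N (B : {set {set 'I_N.+1}}) x : Prop :=
  exists y, (paired B y x /\ odd (y + x)) \/ (paired B x y /\ ~~ odd (x + y)).

Lemma matched_opener_closer N (B : {set {set 'I_N.+1}}) x :
  matched B x <-> opener B x \/ closer B x.
Proof.
split=> [[y [p|p]]|[[y [[p _]|[p _]]]|[y [[p _]|[p _]]]]]; try by exists y; auto.
  by case o: (odd (x + y)); [left | right]; exists y; rewrite o; auto.
by case o: (odd (y + x)); [right | left]; exists y; rewrite o; auto.
Qed.

(** By disjointness only the arc that starts at x distinguishes the gaps x-1 and x, and the sets
    [[kl]] that contain x belong to the arcs over gap x. Hence the larger of the two depths carries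
    the parity of b(x). *)
Lemma opener_depth N (B : {set {set 'I_N.+1}}) x : inP B -> opener B x ->
  depth B x = (depth B x.-1).+1 /\ (inord x \in epsbase B) = odd (depth B x).
Proof.
move=> BP [y pxy].
have xN : 0 < x <= N.
  by case: pxy => [[p _]|[p _]]; have := paired_lt p; have := paired_gt0 BP p; lia.
have other k l : paired B k l ->
    k = x /\ l = y /\ odd (x + y) \/ k = y /\ l = x /\ ~~ odd (y + x) \/ k <> x /\ l <> x.
  move=> pkl; case: pxy => -[p o]; case: (paired_disj BP p pkl); lia.
split.
  case: pxy => -[p o]; have lt := paired_lt p.
    apply: (depth_succ BP p); rewrite /covers ?o ?(negPf o); try lia.
    by move=> k l pkl; have := paired_lt pkl; have := other _ _ pkl; case: ifP; lia.
  apply: (depth_succ BP p); rewrite /covers ?o ?(negPf o); try lia.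
  by move=> k l pkl; have := paired_lt pkl; have := other _ _ pkl; case: ifP; lia.
apply: epsbase_depth => // k l pkl; have := paired_lt pkl; have := other _ _ pkl; rewrite /covers.
by case: ifP; lia.
Qed.

Lemma closer_depth N (B : {set {set 'I_N.+1}}) x : inP B -> closer B x ->
  depth B x.-1 = (depth B x).+1 /\ (inord x \in epsbase B) = odd (depth B x.-1).
Proof.
move=> BP [y pxy].
have xN : 0 < x <= N.
  by case: pxy => [[p _]|[p _]]; have := paired_lt p; have := paired_gt0 BP p; lia.
have other k l : paired B k l ->
    k = x /\ l = y /\ ~~ odd (x + y) \/ k = y /\ l = x /\ odd (y + x) \/ k <> x /\ l <> x.
  move=> pkl; case: pxy => -[p o]; case: (paired_disj BP p pkl); lia.
split.
  case: pxy => -[p o]; have lt := paired_lt p.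
    apply: (depth_succ BP p); rewrite /covers ?o ?(negPf o); try lia.
    by move=> k l pkl; have := paired_lt pkl; have := other _ _ pkl; case: ifP; lia.
  apply: (depth_succ BP p); rewrite /covers ?o ?(negPf o); try lia.
  by move=> k l pkl; have := paired_lt pkl; have := other _ _ pkl; case: ifP; lia.
apply: epsbase_depth => // k l pkl; have := paired_lt pkl; have := other _ _ pkl; rewrite /covers.
by case: ifP; lia.
Qed.

Lemma depth0 N (B : {set {set 'I_N.+1}}) : inP B -> depth B 0 = sB B.
Proof.
move=> BP; rewrite /depth /sB; congr #|pred_of_set _|; apply/setP=> Q; rewrite inE.
have [QB|nQB] := boolP (Q \in B); last by rewrite inE (negPf nQB).
have [k [l [pkl k0 ->]]] := inP_card BP QB.
by rewrite mem_B0 ?covers_setE ?(paired_lt pkl) // pkl /covers; case: ifP; lia.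
Qed.

Lemma depthN N (B : {set {set 'I_N.+1}}) : inP B -> depth B N = sB B.
Proof.
move=> BP; rewrite /depth /sB; congr #|pred_of_set _|; apply/setP=> Q; rewrite inE.
have [QB|nQB] := boolP (Q \in B); last by rewrite inE (negPf nQB).
have [k [l [pkl k0 ->]]] := inP_card BP QB.
have lt := paired_lt pkl.
by rewrite mem_B0 ?covers_setE // pkl /covers; case: ifP; lia.
Qed.

(** * Noncrossing matchings *)

(** As arcs on the circle the two are equal, nested or disjoint. An even arc is the outside of its
    two points, so an even pair inside an odd one, or two even pairs side by side, would overlap
    without nesting; the parity clauses exclude these. *)
Definition noncrossing (i j k l : nat) : Prop :=
  (i = k /\ j = l) \/
  (i < k /\ l < j /\ (odd (i + j) -> odd (k + l))) \/
  (k < i /\ j < l /\ (odd (k + l) -> odd (i + j))) \/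
  ((j < k \/ l < i) /\ (odd (i + j) \/ odd (k + l))).

Lemma noncrossing_sym i j k l : noncrossing i j k l -> noncrossing k l i j.
Proof.
case=> [[-> ->]|[h|[h|[h o]]]]; rewrite /noncrossing; first by left.
- by right; right; left.
- by right; left.
by right; right; right; tauto.
Qed.

Lemma noncrossing_even i j k l : noncrossing i j k l -> ~~ odd (i + j) -> ~~ odd (k + l) ->
  (i = k /\ j = l) \/ (i < k /\ l < j) \/ (k < i /\ j < l).
Proof.
case=> [h|[[h1 [h2 _]]|[[h1 [h2 _]]|[_ [o|o]]]]] oij okl.
- by left.
- by right; left.
- by right; right.
- by rewrite o in oij.
by rewrite o in okl.
Qed.

(** Together with [between] this is the pointwise equivalent of [starP], by [star_elim] and
    [star_intro]. *)
Record noncrossing_matching N (B : {set {set 'I_N.+1}}) : Prop := NoncrossingMatching {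
  wg_inP : inP B;
  wg_noncrossing : forall i j k l, paired B i j -> paired B k l -> noncrossing i j k l;
  wg_inner : forall i j x, paired B i j -> odd (i + j) -> i < x < j -> matched B x }.

(** The pointwise form of condition (I), by [condI_outer]. *)
Definition outer N (B : {set {set 'I_N.+1}}) : Prop :=
  forall i j x, paired B i j -> ~~ odd (i + j) -> 0 < x <= N -> x < i \/ j < x -> matched B x.

Definition good N (B : {set {set 'I_N.+1}}) : Prop := noncrossing_matching B /\ outer B.

Lemma depth_mono N (B : {set {set 'I_N.+1}}) y z : inP B ->
  (forall k l, paired B k l -> covers k l y -> covers k l z) -> depth B y <= depth B z.
Proof.
move=> BP h; apply: subset_leq_card; apply/subsetP=> Q; rewrite in_set [in X in _ -> X]in_set.
case/andP=> QB; rewrite QB; have [k [l [pkl _ ->]]] := inP_card BP QB.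
rewrite !covers_setE ?(paired_lt pkl) //; exact: h.
Qed.

Lemma unmatched_depth N (B : {set {set 'I_N.+1}}) x : good B -> 0 < x <= N -> ~ matched B x ->
  [/\ depth B x = 0, depth B x.-1 = 0 & inord x \notin epsbase B].
Proof.
move=> [gB oB] xN nx; have BP := wg_inP gB.
have unc k l : paired B k l -> x <> k /\ x <> l /\ ~ (odd (k + l) /\ k < x < l) /\
    ~ (~~ odd (k + l) /\ (x < k \/ l < x)).
  move=> p; have [mk ml] := paired_matched p; split; first by move=> e; subst.
  split; first by move=> e; subst.
  split; first by case=> o lt; apply: nx; apply: wg_inner p o lt.
  by case=> o lt; apply: nx; apply: oB p o _ lt.
have z y : (forall k l, paired B k l -> ~~ covers k l y) -> depth B y = 0.
  move=> h; apply/eqP; rewrite cards_eq0 -subset0; apply/subsetP=> Q; rewrite in_set.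
  case/andP=> QB; have [k [l [pkl _ ->]]] := inP_card BP QB.
  by rewrite covers_setE ?(paired_lt pkl) // (negPf (h _ _ pkl)).
have dx0 : depth B x = 0.
  by apply: z => k l p; have := unc _ _ p; have := paired_lt p; rewrite /covers; case: ifP; lia.
split=> //.
  by apply: z => k l p; have := unc _ _ p; have := paired_lt p; rewrite /covers; case: ifP; lia.
rewrite (epsbase_depth (y := x)) // ?dx0 // => k l p.
by have := unc _ _ p; have := paired_lt p; rewrite /covers; case: ifP; lia.
Qed.

(** The flat step comes from the truncated predecessor [0.-1 = 0]: at depth 0 and b = 0,
    [odd 0 = false] selects that branch. *)
Definition depth_step (d : nat) (b : bool) : nat := if odd d == b then d.-1 else d.+1.

Lemma depth_rec N (B : {set {set 'I_N.+1}}) x : good B -> 0 < x <= N ->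
  depth B x = depth_step (depth B x.-1) (inord x \in epsbase B).
Proof.
move=> gB xN; have BP := wg_inP (proj1 gB).
have xN' : x <= N by lia.
have [/matched_opener_closer[]|] := matched_dec BP xN'.
- by move=> o; have [dx ->] := opener_depth BP o; rewrite /depth_step dx /=; case: (odd _).
- by move=> o; have [dx ->] := closer_depth BP o; rewrite /depth_step eqxx dx.
by move=> o; have [-> -> /negPf ->] := unmatched_depth gB xN o.
Qed.

(** * Arcs of a depth profile *)

Definition steps (N : nat) (d : nat -> nat) : Prop := forall x, 0 < x <= N ->
  d x = (d x.-1).+1 \/ d x.-1 = (d x).+1 \/ (d x = 0 /\ d x.-1 = 0).

Lemma depth_step_steps N d (b : nat -> bool) :
  (forall x, 0 < x <= N -> d x = depth_step (d x.-1) (b x)) -> steps N d.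
Proof. by move=> h x xN; rewrite h // /depth_step; case: ifP => _; case: (d x.-1); lia. Qed.

(** The matching rule in terms of the profile alone, so that it makes sense before any matching
    exists. In the odd case equal depth at the gaps i-1 and j follows from [steps]; in the even case
    the other clauses leave the depth at j-1 too free, so equality with the depth at i is
    imposed. *)
Definition depth_pair (N : nat) (d : nat -> nat) (i j : nat) : Prop :=
  (0 < i /\ i < j <= N) /\
  ((odd (i + j) /\ d i.-1 < d i /\ d j < d i /\ forall y, i <= y < j -> d i <= d y) \/
   (~~ odd (i + j) /\ d i < d i.-1 /\ d j.-1 < d j /\ d i = d j.-1 /\
     forall y, y < i \/ j <= y <= N -> d i < d y)).

Lemma depth_pair_ext N d d' i j : (forall x, x <= N -> d x = d' x) -> depth_pair N d i j ->
  depth_pair N d' i j.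
Proof.
move=> e [ij h]; split=> //; case: h => [[o [h1 [h2 h3]]]|[o [h1 [h2 [h3 h4]]]]]; [left | right].
  do !split=> //; rewrite -?e //; try lia.
  by move=> y yij; rewrite -!e; try lia; apply: h3.
do !split=> //; rewrite -?e //; try lia.
by move=> y yij; rewrite -!e; try lia; apply: h4.
Qed.

(* The arc of a pair sits at one level e: the depth is e at the two gaps just
   outside the arc and exceeds e at all gaps covered by the arc. *)
Lemma depth_pair_level N d i j : steps N d -> depth_pair N d i j ->
  exists e,
  (odd (i + j) /\ d i.-1 = e /\ d j = e /\ forall y, i <= y < j -> e < d y) \/
  (~~ odd (i + j) /\ d i = e /\ d j.-1 = e /\ forall y, y < i \/ j <= y <= N -> e < d y).
Proof.
move=> st [ij [[o [h1 [h2 h3]]]|[o [h1 [h2 [h3 h4]]]]]]; last first.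
  by exists (d i); right.
exists (d j); left; have si := st i; have sj := st j; have := h3 j.-1 => hj.
do !split=> //; first lia.
by move=> y yij; have := h3 y; lia.
Qed.

(** A gap of depth e cannot lie under an arc of level e' >= e, where the depth exceeds e'. Applied
    to the gaps just outside the arc of smaller level, this leaves nested or disjoint arcs; if the
    levels differ, the boundary gaps differ too, which makes the inequalities strict. *)
Lemma depth_pair_noncrossing N d i j k l : steps N d -> depth_pair N d i j ->
  depth_pair N d k l -> noncrossing i j k l.
Proof.
move=> st rij rkl; have [ij kl] := (rij.1, rkl.1).
have [e] := depth_pair_level st rij; have [e'] := depth_pair_level st rkl.
have same x y : d x = e -> d y = e' -> x = y -> e = e' by move=> <- <- ->.
case=> [[o' [h1' [h2' h3']]]|[o' [h1' [h2' h3']]]];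
case=> [[o [h1 [h2 h3]]]|[o [h1 [h2 h3]]]].
- have same1 := same _ _ h1 h1'; have same2 := same _ _ h2 h2'.
  have out' x : d x = e -> e <= e' -> x < k \/ l <= x.
    by move=> dx le; have := h3' x; rewrite dx; lia.
  have out x : d x = e' -> e' <= e -> x < i \/ j <= x.
    by move=> dx le; have := h3 x; rewrite dx; lia.
  have : (i = k /\ j = l) \/ (i < k /\ l < j) \/ (k < i /\ j < l) \/ (j < k \/ l < i).
    have [lt|gt|eq] := ltngtP e e'.
    + have := out' _ h1 (ltnW lt); have := out' _ h2 (ltnW lt).
      have n1 : i.-1 <> k.-1 by move=> /same1; lia.
      have n2 : j <> l by move=> /same2; lia.
      by clear -ij kl n1 n2; lia.
    + have := out _ h1' (ltnW gt); have := out _ h2' (ltnW gt).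
      have n1 : i.-1 <> k.-1 by move=> /same1; lia.
      have n2 : j <> l by move=> /same2; lia.
      by clear -ij kl n1 n2; lia.
    have le : e <= e' by rewrite eq.
    have ge : e' <= e by rewrite eq.
    have := out' _ h1 le; have := out' _ h2 le; have := out _ h1' ge; have := out _ h2' ge.
    by clear -ij kl; lia.
  by rewrite /noncrossing; tauto.
- have [lt|le] := ltnP e e'; last first.
    have := h3 k.-1; have := h3 l; rewrite h1' h2' => a1 a2.
    have [ik lj] : i < k /\ l < j by clear -ij kl le a1 a2; lia.
    by right; left; rewrite o'.
  have n1 : i <> l by move=> /(same _ _ h1 h2'); lia.
  have n2 : j.-1 <> k.-1 by move=> /(same _ _ h2 h1'); lia.
  have := h3' i; have := h3' j.-1; rewrite h1 h2 => a1 a2.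
  have : (i < k /\ l < j) \/ (j < k \/ l < i) by clear -ij kl lt n1 n2 a1 a2; lia.
  by rewrite /noncrossing; tauto.
- have [lt|le] := ltnP e' e; last first.
    have := h3' i.-1; have := h3' j; rewrite h1 h2 => a1 a2.
    have [ki jl] : k < i /\ j < l by clear -ij kl le a1 a2; lia.
    by right; right; left; rewrite o.
  have n1 : j <> k by move=> /(same _ _ h2 h1'); lia.
  have n2 : i.-1 <> l.-1 by move=> /(same _ _ h1 h2'); lia.
  have := h3 k; have := h3 l.-1; rewrite h1' h2' => a1 a2.
  have : (k < i /\ j < l) \/ (j < k \/ l < i) by clear -ij kl lt n1 n2 a1 a2; lia.
  by rewrite /noncrossing; tauto.
have inside' : e <= e' -> k <= i /\ j <= l.
  by move=> le; have := h3' i; have := h3' j.-1; rewrite h1 h2 => a1 a2; clear -ij kl le a1 a2;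
    lia.
have inside : e' <= e -> i <= k /\ l <= j.
  by move=> le; have := h3 k; have := h3 l.-1; rewrite h1' h2' => a1 a2; clear -ij kl le a1 a2;
    lia.
have same1 := same _ _ h1 h1'; have same2 := same _ _ h2 h2'.
have [lt|gt|eq] := ltngtP e e'.
- have [ki jl] := inside' (ltnW lt).
  have n1 : i <> k by move=> /same1; lia.
  have n2 : j.-1 <> l.-1 by move=> /same2; lia.
  by right; right; left; rewrite (negPf o'); clear -ij kl ki jl n1 n2; lia.
- have [ik lj] := inside (ltnW gt).
  have n1 : i <> k by move=> /same1; lia.
  have n2 : j.-1 <> l.-1 by move=> /same2; lia.
  by right; left; rewrite (negPf o); clear -ij kl ik lj n1 n2; lia.
have le : e <= e' by rewrite eq.
have ge : e' <= e by rewrite eq.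
by left; have := inside' le; have := inside ge; clear; lia.
Qed.

Lemma depth_pair_disj N d i j k l : steps N d -> depth_pair N d i j -> depth_pair N d k l ->
  (i = k /\ j = l) \/ (i <> k /\ i <> l /\ j <> k /\ j <> l).
Proof.
move=> st rij rkl; have [ij kl] := (rij.1, rkl.1).
by have := depth_pair_noncrossing st rij rkl; rewrite /noncrossing; lia.
Qed.

(** * The matching of a depth profile *)

Lemma first_in (P : pred nat) a b : a <= b -> P b ->
  exists m, [/\ a <= m <= b, P m & forall y, a <= y < m -> ~~ P y].
Proof.
move=> ab Pb; have ex : exists m, (a <= m) && P m by exists b; rewrite ab.
case: (ex_minnP ex) => m /andP[am Pm] mmin; exists m; split=> //.
  by rewrite am mmin // ab.
move=> y /andP[ay ym]; apply/negP=> Py; have := mmin y; rewrite ay Py; lia.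
Qed.

Lemma last_in (P : pred nat) a b : a <= b -> P a ->
  exists m, [/\ a <= m <= b, P m & forall y, m < y <= b -> ~~ P y].
Proof.
move=> ab Pa; have ex : exists m, (a <= m <= b) && P m by exists a; rewrite leqnn ab.
have bd m : (a <= m <= b) && P m -> m <= b by case/andP=> /andP[].
case: (ex_maxnP ex bd) => m /andP[am Pm] mmax; exists m; split=> //.
move=> y yb; apply/negP=> Py; have := mmax y; rewrite Py; lia.
Qed.

(** A step that is not flat changes both d y and y by one; the hypothesis excludes flat steps, whose
    two depths are 0. *)
Lemma steps_parity N d a b : steps N d -> a <= b <= N ->
  (forall y, a < y <= b -> 0 < d y \/ 0 < d y.-1) -> odd (d b + b) = odd (d a + a).
Proof.
move=> st; elim: b => [|b IHb] ab h; first by have -> : a = 0 by lia.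
have [->//|ab'] : a = b.+1 \/ a <= b by lia.
rewrite -IHb; try lia; last by move=> y yab; apply: h; lia.
have := st b.+1; have := h b.+1; rewrite /=; clear IHb h st; lia.
Qed.

(** The arc opened at x ends where the depth first returns to its value before x, either to the
    right of x or after passing N; [steps_parity] gives the pair the parity of its route. *)
Lemma depth_pair_up N d x : steps N d -> d 0 = d N -> odd N -> 0 < x <= N -> d x.-1 < d x ->
  exists y, (depth_pair N d x y /\ odd (x + y)) \/ (depth_pair N d y x /\ ~~ odd (y + x)).
Proof.
move=> st d0N oN xN ux.
case: (boolP [exists y : 'I_N.+1, (x <= y) && (d y < d x)]) => [/existsP[y /andP[xy dy]]|].
  have [m [mxy dm mfirst]] := first_in (P := fun y => d y < d x) xy dy.
  have yN := ltn_ord y.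
  have par : odd (d m + m) = odd (d x.-1 + x.-1).
    apply: (steps_parity st); first lia.
    by move=> z zm; have := mfirst z.-1; have zx : z = x -> d z = d x; [by move=> -> | lia].
  have m_x : x < m.
    have [e|//] : m = x \/ x < m by lia.
    by subst; lia.
  have dx : d m = d x.-1.
    have := st m; have := st x; have := mfirst m.-1.
    by clear -xN ux m_x mxy yN dm; lia.
  exists m; left; have o : odd (x + m) by clear -par dx xN; lia.
  split=> //; split; first by clear -xN m_x mxy yN; lia.
  left; do !split=> //.
  by move=> z zm; have := mfirst z; lia.
move=> /existsPn nex.
have ge y : x <= y <= N -> d x <= d y.
  by move=> xy; have := nex (inord y); rewrite inordK; lia.
have := ge N; rewrite -d0N => dx0.
have [|m [mxy dm mfirst]] := first_in (P := fun y => d y <= d x.-1) (leq0n x.-1); first lia.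
have m0 : 0 < m by case: (m) dm => //; lia.
(* Parity is followed along [0,m] and [x-1,N]; the stretches join through d 0 = d N, and the odd N
   makes m + x even. *)
have par1 : odd (d m + m) = odd (d 0 + 0).
  by apply: (steps_parity st); [lia | move=> z zm; have := mfirst z.-1; lia].
have par2 : odd (d N + N) = odd (d x.-1 + x.-1).
  by apply: (steps_parity st); [lia | move=> z zm; have := ge z; lia].
have mb := mfirst m.-1.
have dx : d m = d x.-1.
  by have := st m; clear -xN m0 mxy dm mb; lia.
exists m; right; have o : ~~ odd (m + x) by clear -par1 par2 dx d0N oN xN; lia.
split=> //; split; first by clear -xN m0 mxy; lia.
right; do !split=> //; first by clear -m0 mb dx; lia.
by move=> z zm; have := mfirst z; have := ge z; clear -zm ux dx; lia.
Qed.

(** The mirror image of [depth_pair_up]: the opener is the point m+1 after the last gap m of depth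
    at most d x, sought to the left of x and then from N downwards. *)
Lemma depth_pair_down N d x : steps N d -> d 0 = d N -> odd N -> 0 < x <= N -> d x < d x.-1 ->
  exists y, (depth_pair N d y x /\ odd (y + x)) \/ (depth_pair N d x y /\ ~~ odd (x + y)).
Proof.
move=> st d0N oN xN ux.
case: (boolP [exists y : 'I_N.+1, (y < x) && (d y <= d x)]) => [/existsP[y /andP[yx dy]]|].
  have yx' : y <= x.-1 by lia.
  have [m [mxy dm mlast]] := last_in (P := fun y => d y <= d x) yx' dy.
  have m_x : m.+1 < x.
    have [e|//] : m = x.-1 \/ m.+1 < x by lia.
    by subst; lia.
  have par : odd (d x + x) = odd (d m + m).
    apply: (steps_parity st); first lia.
    by move=> z zm; have := mlast z; have zx : z = x -> d z.-1 = d x.-1; [by move=> -> | lia].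
  have mb := mlast m.+1.
  have [dx dm1] : d m = d x /\ d m.+1 = (d x).+1.
    by have := st m.+1; rewrite /=; clear -xN mxy m_x dm mb; lia.
  exists m.+1; left; have o : odd (m.+1 + x) by clear -par dx; lia.
  split=> //; split; first by clear -xN m_x; lia.
  left; do !split=> //=; try by rewrite dm1 ?dx.
  by move=> z zm; have := mlast z; clear -zm dm1 xN; lia.
move=> /existsPn nex.
have gt y : y < x -> d x < d y.
  by move=> xy; have := nex (inord y); rewrite inordK; lia.
have xN' : x <= N by lia.
have := gt 0; rewrite d0N => dx0.
have [|m [mxy dm mlast]] := last_in (P := fun y => d y <= d x) xN' => //.
have mN : m < N.
  have [e|//] : m = N \/ m < N by lia.
  by subst; lia.
have par1 : odd (d x + x) = odd (d 0 + 0).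
  by apply: (steps_parity st); [lia | move=> z zm; have := gt z.-1; lia].
have par2 : odd (d N + N) = odd (d m + m).
  by apply: (steps_parity st); [lia | move=> z zm; have := mlast z; lia].
have mb := mlast m.+1.
have [dx dm1] : d m = d x /\ d m < d m.+1.
  by have := st m.+1; rewrite /=; clear -mxy mN dm mb; lia.
exists m.+1; right; have o : ~~ odd (x + m.+1) by clear -par1 par2 dx d0N oN; lia.
have xm : x <> m.+1 by move=> e; move: dm1; rewrite -e dx ltnn.
split=> //; split; first by clear -xN mxy mN xm; lia.
right; do !split=> //=.
by move=> z zm; have := mlast z; have := gt z; clear -zm; lia.
Qed.

Definition depth_pairb (N : nat) (d : nat -> nat) (i j : nat) : bool :=
  (0 < i < j) && (j <= N) &&
  (if odd (i + j)
   then [&& d i.-1 < d i, d j < d i & [forall y : 'I_N.+1, (i <= y < j) ==> (d i <= d y)]]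
   else [&& d i < d i.-1, d j.-1 < d j, d i == d j.-1 &
           [forall y : 'I_N.+1, (y < i) || (j <= y <= N) ==> (d i < d y)]]).

Lemma depth_pairP N d i j : reflect (depth_pair N d i j) (depth_pairb N d i j).
Proof.
apply: (iffP andP) => [[ij h]|[ij h]]; (split; first lia).
  case: ifP h => o; last first.
    case/and4P=> h1 h2 /eqP h3 /forallP h4; right; do !split=> //; move=> y yij.
    by have := h4 (inord y); rewrite inordK; lia.
  case/and3P=> h1 h2 /forallP h3; left; do !split=> //; move=> y yij.
  by have := h3 (inord y); rewrite inordK; lia.
case: h => [[o [h1 [h2 h3]]]|[o [h1 [h2 [h3 h4]]]]]; rewrite ?o ?(negPf o) h1 h2 /=.
  by apply/forallP=> y; apply/implyP=> yij; apply: h3.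
rewrite h3 eqxx; apply/forallP=> y; apply/implyP=> yij; rewrite -h3; apply: h4; lia.
Qed.

Definition depth_matching (N : nat) (d : nat -> nat) : {set {set 'I_N.+1}} :=
  [set [set inord i.1; inord i.2] | i : 'I_N.+1 * 'I_N.+1 & depth_pairb N d i.1 i.2].

Lemma paired_depth_matching N d i j : paired (depth_matching N d) i j <-> depth_pair N d i j.
Proof.
split=> [/and3P[ij jN /imsetP[[k l] /= /[!inE] /depth_pairP kl]]|ij].
  have kl' := kl.1; case/set2_inord_inj; rewrite /= in kl kl' *; try lia.
  by move=> -> ->.
case: (ij) => ij' _; rewrite /paired; have [-> ->] : i < j /\ j <= N by lia.
have [ki kj] : nat_of_ord (inord i : 'I_N.+1) = i /\ nat_of_ord (inord j : 'I_N.+1) = j.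
  by rewrite !inordK; lia.
by apply/imsetP; exists (inord i, inord j); rewrite ?inE /= ki kj //; apply/depth_pairP.
Qed.

Lemma depth_matching_inP N d : steps N d -> inP (depth_matching N d).
Proof.
move=> st.
have rep P : P \in depth_matching N d -> exists i j, depth_pair N d i j /\ P = [set inord i;
  inord j].
  by case/imsetP=> -[i j]; rewrite inE => /depth_pairP /= ij ->; exists i, j.
apply/andP; split; apply/forallP=> P; apply/implyP=> /rep[i [j [ij ->]]].
  have ij' := ij.1; apply/andP; split.
    by apply/eqP; rewrite cards2 inord_eq; lia.
  by apply/forallP=> x; apply/implyP; rewrite mem_inord2; lia.
apply/forallP=> Q; apply/implyP=> /rep[k [l [kl ->]]]; apply/implyP=> ne.
have [ij' kl'] := (ij.1, kl.1).
apply/pred0P=> x /=; rewrite !mem_inord2; try lia.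
case: (depth_pair_disj st ij kl) => [[e e']|]; last lia.
by subst; rewrite eqxx in ne.
Qed.

Lemma depth_matching_matched N d x : steps N d -> d 0 = d N -> odd N -> 0 < x <= N ->
  0 < d x \/ 0 < d x.-1 -> matched (depth_matching N d) x.
Proof.
move=> st d0 oN xN pos; apply/matched_opener_closer.
have [u|u] : d x.-1 < d x \/ d x < d x.-1 by have := st x; lia.
  have [y h] := depth_pair_up st d0 oN xN u; left; exists y.
  by case: h => -[/paired_depth_matching]; auto.
have [y h] := depth_pair_down st d0 oN xN u; right; exists y.
by case: h => -[/paired_depth_matching]; auto.
Qed.

Lemma depth_matching_good N d : steps N d -> d 0 = d N -> odd N -> good (depth_matching N d).
Proof.
move=> st d0 oN; split; first split.
- exact: depth_matching_inP.
- by move=> i j k l /paired_depth_matching ij /paired_depth_matching kl;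
  apply: depth_pair_noncrossing st ij kl.
- move=> i j x /paired_depth_matching[ij h] o xij; apply: depth_matching_matched => //; first lia.
  by case: h => [[_ [h1 [h2 h3]]]|]; [have := h3 x; lia | lia].
move=> i j x /paired_depth_matching[ij h] o xN xij; apply: depth_matching_matched => //.
case: h => [|[_ [h1 [h2 [h3 h4]]]]]; first lia.
by have := h4 x; lia.
Qed.

(** * Recovery of a matching from its depth *)

(** Arcs being nested or disjoint, any arc over an extreme gap of the arc of ij is over all its
    gaps, so the depth along that arc is smallest at its ends; [depth_mono] turns the inclusions
    into inequalities. *)
Lemma good_depth_pair N (B : {set {set 'I_N.+1}}) i j : good B -> paired B i j ->
  depth_pair N (depth B) i j.
Proof.
move=> [gB oB] ij; have BP := wg_inP gB; have i0 := paired_gt0 BP ij; have lt := paired_lt ij.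
have nc k l : paired B k l -> noncrossing i j k l /\ k < l.
  by move=> kl; split; [exact: wg_noncrossing gB _ _ _ _ ij kl | have := paired_lt kl; lia].
have mono y z : (forall k l, noncrossing i j k l /\ k < l -> covers k l y -> covers k l z) ->
    depth B y <= depth B z.
  by move=> h; apply: (depth_mono BP) => k l kl; apply: h; apply: nc.
split; first lia; case o: (odd (i + j)).
  have oi : opener B i by exists j; left.
  have cj : closer B j by exists i; left.
  have [[di _] [dj _]] := (opener_depth BP oi, closer_depth BP cj).
  left; do !split=> //; first lia.
    have : depth B j.-1 <= depth B i.
      by apply: mono => k l; rewrite /noncrossing /covers; case: ifP; lia.
    lia.
  by move=> y yij; apply: mono => k l; rewrite /noncrossing /covers; case: ifP; lia.
have oj : opener B j by exists i; right; rewrite o.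
have ci : closer B i by exists j; right; rewrite o.
have [[dj _] [di _]] := (opener_depth BP oj, closer_depth BP ci).
have e : depth B i = depth B j.-1.
  apply/eqP; rewrite eqn_leq; apply/andP.
  by split; apply: mono => k l; rewrite /noncrossing /covers; case: ifP; lia.
right; do !split=> //; try lia.
move=> y [yi|yj].
  have : depth B i.-1 <= depth B y by apply: mono => k l; rewrite /noncrossing /covers;
    case: ifP; lia.
  lia.
have : depth B j <= depth B y by apply: mono => k l; rewrite /noncrossing /covers; case: ifP; lia.
lia.
Qed.

Lemma good_steps N (B : {set {set 'I_N.+1}}) : good B -> steps N (depth B).
Proof. by move=> gB; apply: depth_step_steps => x xN; apply: depth_rec. Qed.

(** For the converse, the depth changes at i, so i is matched, and two pairs of one profile that
    share a point coincide. *)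
Lemma good_pairedE N (B : {set {set 'I_N.+1}}) i j : good B ->
  paired B i j <-> depth_pair N (depth B) i j.
Proof.
move=> gB; split=> [|rij]; first exact: good_depth_pair.
have BP := wg_inP gB.1; have [ij hij] := rij.
have iN : i <= N by lia.
have [[y [p|p]]|ni] := matched_dec BP iN.
- by have := depth_pair_disj (good_steps gB) rij (good_depth_pair gB p) => -[[_ ->]//|]; lia.
- by have := depth_pair_disj (good_steps gB) rij (good_depth_pair gB p); lia.
have iN' : 0 < i <= N by lia.
have [di di' _] := unmatched_depth gB iN' ni; lia.
Qed.

Lemma paired_inj N (B B' : {set {set 'I_N.+1}}) : inP B -> inP B' ->
  (forall i j, paired B i j <-> paired B' i j) -> B = B'.
Proof.
move=> BP BP' h; apply/setP=> P; apply/idP/idP => PB.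
  have [i [j [/h /and3P[_ _]]]] := inP_card BP PB; by move=> + _ ->.
have [i [j [/h /and3P[_ _]]]] := inP_card BP' PB; by move=> + _ ->.
Qed.

Lemma good_inj N (B B' : {set {set 'I_N.+1}}) : good B -> good B' ->
  (forall x, x <= N -> depth B x = depth B' x) -> B = B'.
Proof.
move=> gB gB' e; apply: paired_inj (wg_inP gB.1) (wg_inP gB'.1) _ => i j.
rewrite good_pairedE // good_pairedE //; split; apply: depth_pair_ext => // x xN; by rewrite e.
Qed.

(** Both profiles rise and fall at the same points, hence differ by a constant; a flat step, where
    both vanish, shows that it is 0. *)
Lemma depth_depth_matching N d x : steps N d -> d 0 = d N -> odd N -> x <= N ->
  depth (depth_matching N d) x = d x.
Proof.
move=> st d0N oN; have gB := depth_matching_good st d0N oN; have BP := wg_inP gB.1.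
have flat y : 0 < y <= N -> d y = 0 -> d y.-1 = 0 ->
  depth (depth_matching N d) y = 0 /\ depth (depth_matching N d) y.-1 = 0.
  move=> yN y0 y1; have [] := @unmatched_depth N (depth_matching N d) y gB yN; last by [].
  case=> z [] /paired_depth_matching [? [[_ [h1 [h2 h3]]]|[_ [h1 [h2 [h3 h4]]]]]]; try lia.
  by have := h3 y.-1; lia.
have shift y : y <= N -> depth (depth_matching N d) y + d 0 = d y + depth (depth_matching N d) 0.
  elim: y => [|y IHy] yN; first by rewrite addnC.
  have yN' : 0 < y.+1 <= N by []; have IH := IHy (ltnW yN).
  have [u|[u|u]] := st y.+1 yN'.
  - have [|z hz] := depth_pair_up st d0N oN yN'; first by rewrite u.
    have oy : opener (depth_matching N d) y.+1 by exists z;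
      case: hz => -[/paired_depth_matching]; auto.
    have [/= e _] := opener_depth BP oy; clear IHy; rewrite /= in u; lia.
  - have [|z hz] := depth_pair_down st d0N oN yN'; first by rewrite u.
    have oy : closer (depth_matching N d) y.+1 by exists z;
      case: hz => -[/paired_depth_matching]; auto.
    have [/= e _] := closer_depth BP oy; clear IHy; rewrite /= in u; lia.
  by have := flat y.+1 yN' u.1 u.2; clear IHy; rewrite /= in u *; lia.
move=> xN; suff : depth (depth_matching N d) 0 = d 0 by have := shift x xN; lia.
case: (boolP [exists y : 'I_N.+1, [&& 0 < y, d y == 0 & d y.-1 == 0]]).
  case/existsP=> y /and3P[y0 /eqP dy /eqP dy'].
  have yN := ltn_ord y; have := shift y; have := flat y; lia.
(* Without a flat step the parity of depth plus position would be constant on [0,N], against d 0 = d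
   N and N odd. *)
move/existsPn=> nflat; suff : odd (d N + N) = odd (d 0 + 0) by lia.
apply: (steps_parity st); first lia.
by move=> y yN; have := nflat (inord y); rewrite inordK; lia.
Qed.

(** * The statistic gamma and the main bijection *)

Definition psi (d : nat) : int :=
  if odd d then (- (d./2.+1)%:Z)%R else Posz d./2.

(** In the list 0, -1, 1, -2, 2, ... of values of [psi], z |-> -z fixes entry 0 and exchanges the
    entries 2k-1 and 2k, while z |-> -1-z exchanges the entries 2k and 2k+1. *)
Lemma psi_depth_step d (b : bool) : psi (depth_step d b) = (- (b : nat)%:Z - psi d)%R.
Proof.
rewrite /psi /depth_step; case: b; case o: (odd d) => /=.
- have -> : odd d.-1 = false by lia.
  lia.
- rewrite o /=; lia.
- rewrite o /=; lia.
by case: d o => // d /= /negbFE o; rewrite o uphalf_half; lia.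
Qed.

Lemma psi_inj : injective psi.
Proof. by move=> d d'; rewrite /psi; case: ifP; case: ifP; lia. Qed.

Lemma psi_surj (z : int) : exists d, psi d = z.
Proof.
case: z => n; first by exists n.*2; rewrite /psi odd_double; lia.
by exists n.*2.+1; rewrite /psi /= odd_double /=; lia.
Qed.

Lemma card_inord N (X : {set 'I_N.+1}) (p : pred nat) :
  #|[set x in X | p x]| = \sum_(0 <= x < N.+1) ((inord x \in X) && p x).
Proof.
rewrite -sum1_card big_mkcond big_mkord; apply: eq_bigr => x _.
by rewrite inE inord_val; case: (_ && _).
Qed.

(** An element x enters with sign -1 and is negated by each later reflection, so after n steps it
    has sign -(-1)^(n-x). For n = N odd this is (-1)^x, its weight in [gamma]. *)
Lemma gamma_psi N (X : {set 'I_N.+1}) (d : nat -> nat) : inS X -> odd N ->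
  (forall x, 0 < x <= N -> d x = depth_step (d x.-1) (inord x \in X)) ->
  psi (d N) = (gamma X - psi (d 0))%R.
Proof.
move=> XS oN hd; rewrite /gamma !(card_inord X (fun x => odd x)) (card_inord X (fun x => ~~ odd x)).
have X0 : inord 0 \notin X.
  by apply/negP=> X0; move/forallP/(_ (inord 0)): XS; rewrite X0 inordK.
pose E n := \sum_(0 <= x < n.+1) ((inord x \in X) && ~~ odd x).
pose O n := \sum_(0 <= x < n.+1) ((inord x \in X) && odd x).
suff h n : n <= N ->
    psi (d n) = (if odd n then ((E n)%:Z - (O n)%:Z) - psi (d 0)
                 else psi (d 0) - ((E n)%:Z - (O n)%:Z))%R.
  by rewrite h // oN.
elim: n => [|n IHn] nN; first by rewrite /E /O !big_nat1 (negPf X0) /= !GRing.subr0.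
have Es : E n.+1 = E n + ((inord n.+1 \in X) && ~~ odd n.+1) by rewrite /E big_nat_recr.
have Os : O n.+1 = O n + ((inord n.+1 \in X) && odd n.+1) by rewrite /O big_nat_recr.
rewrite hd // psi_depth_step /= (IHn (ltnW nN)) Es Os /=.
by case: (odd n); case: (_ \in X) => /=; lia.
Qed.

Lemma card_parity N (X : {set 'I_N.+1}) :
  #|X| = #|[set x in X | odd x]| + #|[set x in X | ~~ odd x]|.
Proof.
rewrite -(cardsID [set x : 'I_N.+1 | odd x] X).
by congr (_ + _); apply: eq_card => x; rewrite !inE // andbC.
Qed.

Lemma gamma_even N (X : {set 'I_N.+1}) : ~~ odd #|X| -> exists z : int, gamma X = (z + z)%R.
Proof.
rewrite (card_parity X) /gamma; set a := #|_|; set b := #|_| => ev.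
(* Half of gamma X = b - a, as a + b is even. *)
exists (b%:Z - ((a + b)./2)%:Z)%R.
by lia.
Qed.

Lemma epsbase_inS N (B : {set {set 'I_N.+1}}) : inP B -> inS (epsbase B).
Proof.
move=> BP; apply/forallP=> x; apply/implyP; rewrite mem_epsbase lt0n; apply: contraL => /eqP x0.
rewrite (_ : [set P in B | x \in dbr P] = set0) ?cards0 //.
apply/setP=> P; rewrite in_set in_set0; apply/negbTE/negP=> /andP[/(inP_card BP)[k [l [kl k0 ->]]]].
have lt := paired_lt kl; rewrite inE => /existsP[i /andP[]].
rewrite mem_inord2; try lia; move=> ik /existsP[j /andP[]].
rewrite mem_inord2; try lia; move=> jk; rewrite /wr x0; case: ifP; lia.
Qed.

Lemma good_gamma N (B : {set {set 'I_N.+1}}) : odd N -> good B ->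
  gamma (epsbase B) = (psi (sB B) + psi (sB B))%R.
Proof.
move=> oN gB; have BP := wg_inP gB.1.
have := gamma_psi (epsbase_inS BP) oN (fun x => depth_rec (x := x) gB).
by rewrite depth0 // depthN //; lia.
Qed.

Lemma card_gamma N (X : {set 'I_N.+1}) (z : int) : gamma X = (z + z)%R -> ~~ odd #|X|.
Proof.
rewrite (card_parity X) /gamma; set a := #|_|; set b := #|_|; lia.
Qed.

Lemma good_inE N (B : {set {set 'I_N.+1}}) : odd N -> good B -> Defs.inE (epsbase B).
Proof.
move=> oN gB; rewrite /Defs.inE epsbase_inS ?(wg_inP gB.1) //.
exact: card_gamma (good_gamma oN gB).
Qed.

Lemma epsbase_inj N (B B' : {set {set 'I_N.+1}}) : odd N -> good B -> good B' ->
  epsbase B = epsbase B' -> B = B'.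
Proof.
move=> oN gB gB' e; apply: good_inj => //.
have e0 : sB B = sB B'.
  by apply: psi_inj; have := good_gamma oN gB; have := good_gamma oN gB'; rewrite e; lia.
elim=> [|x IHx] xN; first by rewrite !depth0 ?(wg_inP gB.1) ?(wg_inP gB'.1).
have xN' : 0 < x.+1 <= N by [].
rewrite (depth_rec gB xN') (depth_rec gB' xN') e succnK IHx; first reflexivity.
exact: ltnW.
Qed.

Lemma epsbase_surj N (X : {set 'I_N.+1}) : odd N -> Defs.inE X ->
  exists2 B, good B & epsbase B = X.
Proof.
move=> oN /andP[XS ev]; have [z gz] := gamma_even ev; have [s sz] := psi_surj z.
have [d hd ds] : exists2 d : nat -> nat,
    forall x, 0 < x <= N -> d x = depth_step (d x.-1) (inord x \in X) & d 0 = s.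
  (* The recurrence generates the profile from s; the choice 2 psi(s) = gamma X makes it close
     up. *)
  exists (fix d n := if n is m.+1 then depth_step (d m) (inord n \in X) else s) => //.
  by case.
have dN : d 0 = d N.
  by apply: psi_inj; rewrite (gamma_psi XS oN hd) gz ds sz; lia.
have st := depth_step_steps hd; have gB := depth_matching_good st dN oN.
exists (depth_matching N d) => //; apply/setP=> x.
have [x0|x0] := posnP x.
  have BS := epsbase_inS (wg_inP gB.1).
  move/forallP/(_ x)/implyP: XS; move/forallP/(_ x)/implyP: BS; rewrite x0.
  by case: (x \in X); case: (x \in _) => // h1 h2; [have := h2 isT | have := h1 isT].
have xN : 0 < x <= N by rewrite x0 -ltnS ltn_ord.
have xN' : x <= N by lia.
have xN'' : x.-1 <= N by lia.
(* The two sets yield the same depths, and [depth_step d] determines its bit because d.-1 and d.+1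
   differ. *)
have := depth_rec gB xN; rewrite (depth_depth_matching st dN oN xN')
  (depth_depth_matching st dN oN xN'') (hd _ xN) inord_val.
by rewrite /depth_step; case: (x \in X); case: (x \in epsbase _); case: (odd _) => //=; lia.
Qed.

(** * Coverings and the sequence i_*(B) *)

(** The pointwise content of the first covering condition of [starP]; the strict bounds make the
    intervals of odd pairs laminar. *)
Definition closed N (B : {set {set 'I_N.+1}}) : Prop :=
  forall i j x, paired B i j -> odd (i + j) -> i < x < j ->
  exists k l, [/\ paired B k l, odd (k + l), i < k, l < j & x = k \/ x = l].

Lemma noncrossing_closed N (B : {set {set 'I_N.+1}}) : noncrossing_matching B -> closed B.
Proof.
move=> gB i j x ij o xij; have [y [p|p]] := wg_inner gB ij o xij.
  exists x, y; have := wg_noncrossing gB ij p; have := paired_lt p; rewrite /noncrossing => lt nc.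
  by split; auto; lia.
exists y, x; have := wg_noncrossing gB ij p; have := paired_lt p; rewrite /noncrossing => lt nc.
by split; auto; lia.
Qed.

Lemma mem_ivl N i j (x : 'I_N.+1) : i < j <= N ->
  (x \in ivl [set inord i; inord j]) = (i <= x <= j).
Proof.
move=> ij; rewrite inE; apply/existsP/idP => [[a /andP[]]|xij].
  rewrite mem_inord2; try lia; move=> aij /existsP[b /andP[]].
  by rewrite mem_inord2; lia.
exists (inord i); rewrite set21; apply/existsP; exists (inord j).
by rewrite set22 !inordK; lia.
Qed.

Lemma B1_paired N (B : {set {set 'I_N.+1}}) P : inP B -> P \in B1 B ->
  exists i j, [/\ paired B i j, odd (i + j) & P = [set inord i; inord j]].
Proof.
move=> BP PB1; have PB : P \in B by move: PB1; rewrite in_setD => /andP[].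
have [i [j [ij _ defP]]] := inP_card BP PB.
by move: PB1; rewrite defP mem_B1 ?(paired_lt ij) // => /andP[_ o]; exists i, j.
Qed.

Lemma mem_itv N a b (x : 'I_N.+1) : (x \in itv N a b) = (a <= x <= b).
Proof. by rewrite inE. Qed.

(** A point interior to a covering interval is, by [closed], an endpoint of a smaller odd pair
    within it. With [covered0_intro] this characterizes 0-covered sets by their points. *)
Lemma covered0_elim N (B : {set {set 'I_N.+1}}) (X : {set 'I_N.+1}) x : inP B -> closed B ->
  covered0 B X -> x \in X ->
  exists k l, [/\ paired B k l, odd (k + l), x = k :> nat \/ x = l :> nat &
                  forall y : 'I_N.+1, k <= y <= l -> y \in X].
Proof.
move=> BP cB /existsP[C /and3P[/subsetP CB /eqP defX _]]; rewrite {1}defX.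
case/bigcupP=> P PC; have [i [j [ij o defP]]] := B1_paired BP (CB _ PC).
rewrite defP mem_ivl ?(paired_lt ij) // => xij.
have sub (y : 'I_N.+1) : i <= y <= j -> y \in X.
  by move=> yij; rewrite defX; apply/bigcupP; exists P; rewrite // defP mem_ivl ?(paired_lt ij).
have [e|xij'] : ((x : nat) = i \/ (x : nat) = j) \/ i < x < j by lia.
  by exists i, j.
have [k [l [kl o' ik lj xkl]]] := cB i j x ij o xij'.
by exists k, l; split=> // y ykl; apply: sub; lia.
Qed.

Lemma closed_laminar N (B : {set {set 'I_N.+1}}) i j k l : inP B -> closed B ->
  paired B i j -> odd (i + j) -> paired B k l -> odd (k + l) ->
  (i <= k /\ l <= j) \/ (k <= i /\ j <= l) \/ j < k \/ l < i.
Proof.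
move=> BP cB ij o kl o'.
have lij := paired_lt ij; have lkl := paired_lt kl.
have inside a b x y : paired B a b -> odd (a + b) -> paired B x y -> 
    (a < x < b -> y <= b) /\ (a < y < b -> a <= x).
  move=> ab oab xy; have lxy := paired_lt xy; split=> lt.
    have [c [e [ce _ ac eb xce]]] := cB _ _ _ ab oab lt.
    by have := paired_disj BP xy ce; lia.
  have [c [e [ce _ ac eb xce]]] := cB _ _ _ ab oab lt.
  by have := paired_disj BP xy ce; lia.
have := inside _ _ _ _ ij o kl; have := inside _ _ _ _ kl o' ij.
by have := paired_disj BP ij kl; lia.
Qed.

(** Intervals of odd pairs are laminar, so the inclusion-maximal ones among those contained in X are
    disjoint, and they cover X. *)
Lemma covered0_intro N (B : {set {set 'I_N.+1}}) (X : {set 'I_N.+1}) : inP B -> closed B ->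
  (forall x : 'I_N.+1, x \in X ->
    exists k l, [/\ paired B k l, odd (k + l), x = k :> nat \/ x = l :> nat &
                  forall y : 'I_N.+1, k <= y <= l -> y \in X]) ->
  covered0 B X.
Proof.
move=> BP cB h.
pose inX (P : {set 'I_N.+1}) := (P \in B1 B) && (ivl P \subset X).
pose C := [set P | inX P && [forall Q, inX Q && (ivl P \subset ivl Q) ==> (ivl Q \subset ivl P)]].
apply/existsP; exists C; apply/and3P; split.
- by apply/subsetP=> P; rewrite inE => /andP[/andP[]].
- apply/eqP/setP=> x; apply/idP/bigcupP => [/h|[P]]; last first.
    by rewrite inE => /andP[/andP[_ /subsetP sub] _]; apply: sub.
  move=> [k [l [kl o xkl sub]]].
  pose P : {set 'I_N.+1} := [set inord k; inord l].
  have lt := paired_lt kl.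
  have PX : inX P && (ivl P \subset ivl P).
    rewrite /inX mem_B1 // kl o subxx andbT /=; apply/subsetP=> y.
    by rewrite mem_ivl // => /sub.
  case: (arg_maxnP (P := fun Q => inX Q && (ivl P \subset ivl Q)) (fun Q => #|ivl Q|) PX).
  move=> Q /andP[QX PQ] Qmax; exists Q; last first.
    by apply: (subsetP PQ); rewrite mem_ivl //; lia.
  rewrite inE QX; apply/forallP=> R; apply/implyP=> /andP[RX QR].
  have /Qmax : inX R && (ivl P \subset ivl R) by rewrite RX (subset_trans PQ QR).
  by move=> le; have [_ <-] := subset_leqif_card QR; rewrite eqn_leq subset_leq_card.
apply/forallP=> P; apply/implyP; rewrite inE => /andP[/[dup] PX /andP[PB _] /forallP Pmax].
apply/forallP=> Q; apply/implyP; rewrite inE => /andP[/[dup] QX /andP[QB _] /forallP Qmax].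
apply/implyP=> neq; apply/pred0P=> x /=; apply/negbTE/negP=> /andP[xP xQ].
have [i [j [ij o defP]]] := B1_paired BP PB; have [k [l [kl o' defQ]]] := B1_paired BP QB.
have [lij lkl] := (paired_lt ij, paired_lt kl).
have nest : ivl P \subset ivl Q \/ ivl Q \subset ivl P.
  have : (k <= i /\ j <= l) \/ (i <= k /\ l <= j).
    by have := closed_laminar BP cB ij o kl o'; move: xP xQ; rewrite defP defQ !mem_ivl //;
      clear; lia.
  by case=> lt; [left | right]; apply/subsetP=> y; rewrite defP defQ !mem_ivl //; move: lt;
    clear; lia.
have eqi : ivl P = ivl Q.
  apply/eqP; rewrite eqEsubset; case: nest => sub; rewrite sub ?andbT /=.
    by have := Pmax Q; rewrite QX sub.
  by have := Qmax P; rewrite PX sub.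
have [ik jl] : i = k /\ j = l; last by move: neq; rewrite defP defQ ik jl eqxx.
have ei y : y <= N -> (i <= y <= j) = (k <= y <= l).
  move=> yN; have /setP/(_ (inord y)) := eqi.
  by rewrite defP defQ !mem_ivl // inordK.
by have := ei i; have := ei j; have := ei k; have := ei l; move: lij lkl; clear; lia.
Qed.

Definition oddcov N (B : {set {set 'I_N.+1}}) : bool :=
  [forall i : 'I_N.+1, forall j : 'I_N.+1,
     (([set i; j] \in B1 B) && wr i j) ==> covered0 B (itv N i.+1 j.-1)].

(** Induction on j - i: the covering interval around x is shorter, and x is one of its endpoints or
    the induction applies to it. *)
Lemma oddcov_closed N (B : {set {set 'I_N.+1}}) : inP B -> oddcov B -> closed B.
Proof.
move=> BP /forallP h.
have cov i j : paired B i j -> odd (i + j) -> covered0 B (itv N i.+1 j.-1).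
  move=> ij o; have lt := paired_lt ij; have /forallP/(_ (inord j))/implyP := h (inord i).
  by rewrite mem_B1 // ij o !inordK /wr; try lia; apply; lia.
move=> i j; have [n] := ubnP (j - i); elim: n i j => // n IHn i j le x ij o xij.
have lt := paired_lt ij; have /existsP[C /and3P[/subsetP CB /eqP defX _]] := cov i j ij o.
have : inord x \in itv N i.+1 j.-1 by rewrite mem_itv inordK; lia.
rewrite {1}defX => /bigcupP[P PC].
have [k [l [kl o' defP]]] := B1_paired BP (CB _ PC); have lkl := paired_lt kl.
have sub y : k <= y <= l -> i < y < j.
  move=> ykl; have : inord y \in itv N i.+1 j.-1.
    by rewrite defX; apply/bigcupP; exists P; rewrite // defP mem_ivl // inordK; lia.
  by rewrite mem_itv inordK; lia.
have := sub k; have := sub l => subl subk.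
rewrite defP mem_ivl // inordK; last lia.
move=> xkl; have [e|xkl'] : (x = k \/ x = l) \/ k < x < l by lia.
  by exists k, l; split=> //; lia.
have ltn : l - k < n by lia.
have [k' [l' [kl' o'' ik lj e]]] := IHn k l ltn x kl o' xkl'.
by exists k', l'; split=> //; lia.
Qed.

Lemma covered0_itv_elim N (B : {set {set 'I_N.+1}}) a b x : inP B -> closed B -> b <= N ->
  covered0 B (itv N a b) -> a <= x <= b ->
  exists k l, [/\ paired B k l, odd (k + l), a <= k, l <= b & x = k \/ x = l].
Proof.
move=> BP cB bN cov xab; have xX : inord x \in itv N a b by rewrite mem_itv inordK; lia.
have [k [l [kl o e sub]]] := covered0_elim BP cB cov xX.
have lt := paired_lt kl; exists k, l; move: e; rewrite inordK; last lia.
move=> e; have := sub (inord k); have := sub (inord l); rewrite !mem_itv !inordK; try lia.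
by move=> h1 h2; split=> //; lia.
Qed.

(** A place where every union of odd intervals can be cut; 0 and N+1 are the barriers at the two
    ends. *)
Definition barrier N (B : {set {set 'I_N.+1}}) (z : nat) : Prop :=
  forall k l, paired B k l -> odd (k + l) -> z < k \/ l < z.

Lemma covered0_itv_intro N (B : {set {set 'I_N.+1}}) c d : inP B -> closed B ->
  barrier B c -> barrier B d -> d <= N.+1 ->
  (forall x, c < x < d -> matched B x /\ forall k l, paired B k l -> x = k \/ x = l ->
    odd (k + l)) ->
  covered0 B (itv N c.+1 d.-1).
Proof.
move=> BP cB bc bd dN h; apply: covered0_intro => // x; rewrite mem_itv => xcd.
have [|[y p] ev] := h x; first lia.
have [k [l [kl e]]] : exists k l, paired B k l /\ (x = k :> nat \/ x = l :> nat).
  by case: p => p; [exists x, y | exists y, x]; auto.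
exists k, l; have o := ev _ _ kl e; split=> //.
have := bc _ _ kl o; have := bd _ _ kl o.
by move=> h1 h2 z; rewrite mem_itv; have := paired_lt kl; lia.
Qed.

Lemma closed_oddcov N (B : {set {set 'I_N.+1}}) : inP B -> closed B -> oddcov B.
Proof.
move=> BP cB; apply/forallP=> i; apply/forallP=> j; apply/implyP=> /andP[ijB w].
have ij : paired B i j /\ odd (i + j).
  apply/andP; case/orP: w => /andP[lt o]; have := ltn_ord i; have := ltn_ord j => jN iN.
    have lt' : i < j <= N by lia.
    by rewrite -(mem_B1 B lt') !inord_val.
  suff : paired B j i && odd (j + i) by lia.
  have lt' : j < i <= N by lia.
  by rewrite -(mem_B1 B lt') !inord_val setUC.
apply: covered0_intro => // x; rewrite mem_itv => xij.
have [|k [l [kl o ik lj e]]] := cB i j x ij.1 ij.2; first lia.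
by exists k, l; split=> // y; rewrite mem_itv; lia.
Qed.

(** * The sequence of even endpoints *)

Lemma sorted_nth_lt sq a b : sorted ltn sq -> a < b < size sq -> nth 0 sq a < nth 0 sq b.
Proof.
move=> srt ab; apply: (sorted_ltn_nth ltn_trans 0 srt); rewrite ?inE; lia.
Qed.

Lemma nth_gap sq a b x : a < b -> nth 0 sq a < x < nth 0 sq b ->
  exists m, [/\ a <= m, m < b & nth 0 sq m <= x < nth 0 sq m.+1].
Proof.
move=> ab xab; have [||m [mab Pm mlast]] := @last_in (fun y => nth 0 sq y <= x) a b; try lia.
have mb : m <> b by move=> e; move: Pm; rewrite e; lia.
by exists m; split; try lia; have := mlast m.+1; lia.
Qed.

(** With indices from 0, entry k is paired with entry 2s-1-k. The gap after entry s-1, between the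
    innermost points, carries no covering condition. *)
Lemma starseq_elim N (B : {set {set 'I_N.+1}}) (f : {ffun 'I_(2 * sB B) -> 'I_N.+1}) :
  inP B -> starseq f ->
  [/\ size (iseq f) = 2 * sB B, sorted ltn (iseq f), forall k, nth 0 (iseq f) k <= N,
      forall i j, paired B i j && ~~ odd (i + j) <->
        exists2 k, k < sB B & i = nth 0 (iseq f) k /\ j = nth 0 (iseq f) (2 * sB B - k).-1 &
      forall k, k < 2 * sB B -> k.+1 != sB B -> k.+1 != 2 * sB B ->
        covered0 B (itv N (nth 0 (iseq f) k).+1 (nth 0 (iseq f) k.+1).-1)].
Proof.
move=> BP /and4P[srt /eqP defB0 _ /forallP cov].
set sq := iseq f in srt defB0 cov *; set s := sB B in defB0 cov *.
have sz : size sq = 2 * s by rewrite /sq /iseq size_map size_enum_ord.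
have leN k : nth 0 sq k <= N.
  have [lt|ge] := ltnP k (size sq); last by rewrite nth_default.
  have /mapP[z _ ->] := mem_nth 0 lt; exact: leq_ord.
split=> // [i j|k ks k1 k2]; last first.
  by have := cov (Ordinal ks); rewrite k1 k2.
split=> [e|[k ks [-> ->]]].
  have /andP[ij _] := e; have lt := paired_lt ij.
  move: e; rewrite -mem_B0 // defB0 => /imsetP[k _].
  have ks := ltn_ord k; rewrite succnK => eqs; rewrite [RHS]setUC in eqs; move: eqs.
  have lts : nth 0 sq k < nth 0 sq (2 * s - k).-1 by apply: sorted_nth_lt => //; lia.
  case/set2_inord_inj; rewrite ?lts ?leN // => -> ->.
  by exists k.
have lts : nth 0 sq k < nth 0 sq (2 * s - k).-1 by apply: sorted_nth_lt => //; lia.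
rewrite -mem_B0 ?lts ?leN // defB0; apply/imsetP; exists (Ordinal ks) => //.
by rewrite setUC.
Qed.

(** The pointwise form of the gap conditions on i_*(B). It is stated for any two even pairs,
    consecutive or not, and so avoids the sequence. *)
Definition between N (B : {set {set 'I_N.+1}}) : Prop :=
  forall i j k l x, paired B i j -> ~~ odd (i + j) -> paired B k l -> ~~ odd (k + l) ->
  i < k -> i < x < k \/ l < x < j -> matched B x.

Lemma star_istar N (B : {set {set 'I_N.+1}}) : starP B ->
  exists2 f : {ffun 'I_(2 * sB B) -> 'I_N.+1}, starseq f & istar B = iseq f.
Proof.
case/and3P=> _ _ /existsP[f hf]; rewrite /istar; case: pickP => [g hg|/(_ f)]; first by exists g.
by rewrite hf.
Qed.

(** Positions in the increasing sequence nest the even pairs, and [closed] keeps odd pairs from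
    crossing anything. A point between two even pairs is an entry of the sequence or lies in a
    covered gap: both ends belong to the same half, so the middle gap is never met. *)
Lemma star_elim N (B : {set {set 'I_N.+1}}) : starP B ->
  [/\ noncrossing_matching B, between B &
      0 < sB B -> [/\ paired B (iS B 1) (iS B (2 * sB B)), ~~ odd (iS B 1 + iS B (2 * sB B)) &
        forall i j, paired B i j -> ~~ odd (i + j) -> iS B 1 <= i /\ j <= iS B (2 * sB B)]].
Proof.
move=> stB; have [f hf eqf] := star_istar stB; case/and3P: stB => BP oc _.
have cB := oddcov_closed BP oc.
have [sz srt leN ev cov] := starseq_elim BP hf.
rewrite /iS eqf; set sq := iseq f in sz srt leN ev cov *; set s := sB B in sz ev cov *.
have lts a b : a < b < 2 * s -> nth 0 sq a < nth 0 sq b.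
  by rewrite -sz; apply: sorted_nth_lt.
have evk i j : paired B i j -> ~~ odd (i + j) ->
    exists2 k, k < s & i = nth 0 sq k /\ j = nth 0 sq (2 * s - k).-1.
  by move=> ij o; apply/ev; rewrite ij.
have inside i j k l : paired B i j -> odd (i + j) -> paired B k l ->
    (i < k < j -> odd (k + l) /\ l < j) /\ (i < l < j -> odd (k + l) /\ i < k).
  move=> ij o kl; have lkl := paired_lt kl; split=> lt.
    have [a [b [ab oab ia bj e]]] := cB _ _ _ ij o lt.
    have dkl := paired_disj BP kl ab.
    by clear -oab lkl ia bj e lt dkl; lia.
  have [a [b [ab oab ia bj e]]] := cB _ _ _ ij o lt.
  have dkl := paired_disj BP kl ab.
  by clear -oab lkl ia bj e lt dkl; lia.
split.
- split=> // [i j k l ij kl|i j x ij o xij]; last first.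
    have [a [b [ab _ _ _ e]]] := cB _ _ _ ij o xij.
    by have [ma mb] := paired_matched ab; case: e => ->.
  have [lij lkl] := (paired_lt ij, paired_lt kl); have dj := paired_disj BP ij kl.
  have := inside _ _ _ _ ij; have := inside _ _ _ _ kl => hk hi.
  case o: (odd (i + j)); case o': (odd (k + l)).
  - by have := hk _ _ o' ij; have := hi _ _ o kl; rewrite /noncrossing; clear -lij lkl dj o o';
    lia.
  - by have := hi _ _ o kl; rewrite /noncrossing; clear -lij lkl dj o o'; lia.
  - by have := hk _ _ o' ij; rewrite /noncrossing; clear -lij lkl dj o o'; lia.
  have [a as_ [ia ja]] := evk _ _ ij (negbT o); have [b bs [kb lb]] := evk _ _ kl (negbT o').
  have [ab|[ab|ba]] : a = b \/ a < b \/ b < a by lia.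
  - by left; rewrite ia ja kb lb ab.
  - have ik : i < k by rewrite ia kb; apply: lts; lia.
    have lj : l < j by rewrite ja lb; apply: lts; lia.
    by right; left; rewrite o.
  have ki : k < i by rewrite ia kb; apply: lts; lia.
  have jl : j < l by rewrite ja lb; apply: lts; lia.
  by right; right; left; rewrite o'.
- move=> i j k l x ij o kl o' ik xik.
  have [a as_ [ia ja]] := evk _ _ ij o; have [b bs [kb lb]] := evk _ _ kl o'.
  have ab : a < b.
    have [//|ba] := ltnP a b; have := lts b a; rewrite -ia -kb.
    have [e|] : b = a \/ b < a by lia.
      by move: kb; rewrite e -ia; lia.
    by lia.
  have key m : m.+1 < 2 * s -> m.+1 != s -> nth 0 sq m <= x < nth 0 sq m.+1 ->
      x <> nth 0 sq m -> matched B x.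
    move=> m1 m2 xm ne; have m0 : m < 2 * s by lia.
    have m3 : m.+1 != 2 * s by lia.
    have := leN m.+1 => lN.
    have lN' : (nth 0 sq m.+1).-1 <= N by lia.
    have [|p [q [pq _ _ _ e]]] := covered0_itv_elim BP cB lN' (cov m m0 m2 m3) (x := x);
      first lia.
    by have [mp mq] := paired_matched pq; case: e => ->.
  have keq m : m < 2 * s -> x = nth 0 sq m -> matched B x.
    move=> ms ->; have [lt|ge] := ltnP m s.
      have /andP[/paired_matched[mp _] _] : paired B (nth 0 sq m) (nth 0 sq (2 * s - m).-1) &&
        ~~ odd (nth 0 sq m + nth 0 sq (2 * s - m).-1) by apply/ev; exists m.
      exact: mp.
    suff /andP[/paired_matched[_ mp] _] : paired B (nth 0 sq (2 * s - m).-1) (nth 0 sq m) &&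
      ~~ odd (nth 0 sq (2 * s - m).-1 + nth 0 sq m) by exact: mp.
    apply/ev; exists (2 * s - m).-1; first lia.
    by split=> //; congr (nth 0 sq _); lia.
  case: xik => xik.
    have [|m [am mb xm]] := @nth_gap sq a b x ab; first by rewrite -ia -kb.
    have [e|ne] : x = nth 0 sq m \/ x <> nth 0 sq m by lia.
      by apply: keq e; lia.
    by apply: key xm ne; clear -am mb bs; lia.
  have ab' : (2 * s - b).-1 < (2 * s - a).-1 by lia.
  have [|m [am mb xm]] := @nth_gap sq _ _ x ab'; first by rewrite -lb -ja.
  have [e|ne] : x = nth 0 sq m \/ x <> nth 0 sq m by lia.
    by apply: keq e; lia.
  by apply: key xm ne; clear -am mb bs; lia.
move=> s0.
have e2 : (2 * s).-1 = (2 * s - 0).-1 by lia.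
have /andP[p o] : paired B (nth 0 sq 0) (nth 0 sq (2 * s).-1) &&
    ~~ odd (nth 0 sq 0 + nth 0 sq (2 * s).-1) by apply/ev; exists 0; rewrite // -e2.
split=> // i j ij oij; have [k ks [-> ->]] := evk _ _ ij oij.
split; first by have [->//|k0] := posnP k; apply: ltnW; apply: lts; lia.
have [->|k0] := posnP k; first by rewrite e2.
by apply: ltnW; apply: lts; lia.
Qed.

Definition even_paired N (B : {set {set 'I_N.+1}}) (i j : nat) : bool :=
  paired B i j && ~~ odd (i + j).

Lemma even_barrier N (B : {set {set 'I_N.+1}}) i j : noncrossing_matching B ->
  even_paired B i j ->
  barrier B i /\ barrier B j.
Proof.
move=> gB /andP[ij o]; have lt := paired_lt ij.
by split=> k l kl o'; have := wg_noncrossing gB ij kl; have := paired_lt kl;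
  rewrite /noncrossing; lia.
Qed.

(** For consecutive even pairs, nesting leaves no even endpoint in either gap; so the gaps are
    matched by odd pairs alone, and even endpoints are barriers. *)
Lemma nested_gaps_cov N (B : {set {set 'I_N.+1}}) i j k l : noncrossing_matching B -> between B ->
  even_paired B i j -> even_paired B k l -> i < k -> (forall a b, even_paired B a b ->
    ~ (i < a < k)) ->
  covered0 B (itv N i.+1 k.-1) /\ covered0 B (itv N l.+1 j.-1).
Proof.
move=> gB bB ij kl ik nob; have BP := wg_inP gB; have cB := noncrossing_closed gB.
have [bi bj] := even_barrier gB ij; have [bk bl] := even_barrier gB kl.
have [/andP[ij' o] /andP[kl' o']] := (ij, kl).
have [lij lkl] := (paired_lt ij', paired_lt kl').
have nst := wg_noncrossing gB ij' kl'.
have evx a b : paired B a b -> ~~ odd (a + b) -> ~ (i < a < k) /\ ~ (l < b < j) /\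
    ~ (i < b < k) /\ ~ (l < a < j).
  move=> ab oab; have e : even_paired B a b by rewrite /even_paired ab.
  have h1 := noncrossing_even (wg_noncrossing gB ab ij') oab o;
    have h2 := noncrossing_even (wg_noncrossing gB ab kl') oab o'.
  have h3 := noncrossing_even nst o o'; have := nob _ _ e; have := paired_lt ab.
  by clear -h1 h2 h3 lij lkl ik; lia.
split.
  apply: covered0_itv_intro => // [|x xik]; first lia.
  split; first by apply: (bB _ _ _ _ _ ij' o kl' o' ik); left.
  by move=> a b ab e; case oab: (odd (a + b)) => //; have := evx _ _ ab (negbT oab); lia.
apply: covered0_itv_intro => // [|x xik]; first lia.
split; first by apply: (bB _ _ _ _ _ ij' o kl' o' ik); right.
by move=> a b ab e; case oab: (odd (a + b)) => //; have := evx _ _ ab (negbT oab); lia.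
Qed.

(** The maximum merely names the unique j; it is 0 if there is none. *)
Definition partner N (B : {set {set 'I_N.+1}}) (i : nat) : nat :=
  \max_(j < N.+1 | paired B i j) j.

Lemma partnerE N (B : {set {set 'I_N.+1}}) i j : inP B -> paired B i j -> partner B i = j.
Proof.
move=> BP ij; have lt := paired_lt ij; apply/eqP; rewrite eqn_leq; apply/andP; split.
  by apply/bigmax_leqP => k ik; have := paired_disj BP ij ik; lia.
have jN : j < N.+1 by lia.
exact: (leq_bigmax_cond (F := fun k : 'I_N.+1 => val k) (Ordinal jN)).
Qed.

(** The first half of i_*(B). *)
Definition lefts N (B : {set {set 'I_N.+1}}) : seq nat :=
  [seq i <- iota 0 N.+1 | [exists j : 'I_N.+1, even_paired B i j]].

Lemma mem_lefts N (B : {set {set 'I_N.+1}}) i :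
  reflect (exists j, even_paired B i j) (i \in lefts B).
Proof.
rewrite mem_filter mem_iota; apply: (iffP andP) => [[/existsP[j ij] _]|[j ij]].
  by exists j.
have lt := paired_lt (proj1 (andP ij)); split; last lia.
by apply/existsP; exists (inord j); rewrite inordK; lia.
Qed.

Lemma sorted_lefts N (B : {set {set 'I_N.+1}}) : sorted ltn (lefts B).
Proof. exact: sorted_filter ltn_trans _ _ (iota_ltn_sorted 0 N.+1). Qed.

Lemma size_lefts N (B : {set {set 'I_N.+1}}) : inP B -> size (lefts B) = sB B.
Proof.
move=> BP; pose g i : {set 'I_N.+1} := [set inord i; inord (partner B i)].
have gP i : i \in lefts B -> exists2 j, even_paired B i j & g i = [set inord i; inord j].
  by case/mem_lefts=> j /[dup] ij /andP[p _]; exists j; rewrite // /g (partnerE BP p).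
have ug : uniq (map g (lefts B)).
  rewrite map_inj_in_uniq; first exact: sorted_uniq ltn_trans ltnn _ (sorted_lefts B).
  move=> i k /gP[j ij ->] /gP[l kl ->] /set2_inord_inj[] //.
    exact: paired_lt (proj1 (andP ij)).
  exact: paired_lt (proj1 (andP kl)).
rewrite -(size_map g) -(card_uniqP ug) /sB; apply: eq_card => P; apply/mapP/idP.
  move=> [i /gP[j /andP[ij o] ->] ->].
  by rewrite mem_B0 ?ij // (paired_lt ij).
move=> PB0; have PB : P \in B by move: PB0; rewrite inE => /andP[].
have [i [j [ij _ defP]]] := inP_card BP PB.
have e : even_paired B i j by rewrite /even_paired -mem_B0 -?defP // (paired_lt ij).
have il : i \in lefts B by apply/mem_lefts; exists j.
by exists i; rewrite // defP /g (partnerE BP ij).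
Qed.

Lemma star_intro N (B : {set {set 'I_N.+1}}) : noncrossing_matching B -> between B -> starP B.
Proof.
move=> gB bB; have BP := wg_inP gB; have cB := noncrossing_closed gB.
apply/and3P; split; [by []|exact: closed_oddcov|].
set s := sB B.
(* The second half of i_*(B) lists the partners in reverse order, which nesting makes increasing. *)
pose ls := lefts B; pose sq := ls ++ rev (map (partner B) ls).
have sls : size ls = s by exact: size_lefts.
have ssq : size sq = 2 * s by rewrite size_cat size_rev size_map sls; lia.
have eL i : i \in ls -> even_paired B i (partner B i).
  by case/mem_lefts=> j /[dup] ij /andP[p _]; rewrite (partnerE BP p).
have nested i k : i \in ls -> k \in ls -> i < k -> partner B k < partner B i.
  move=> /eL /andP[ij o] /eL /andP[kl o'] ik.
  by have := noncrossing_even (wg_noncrossing gB ij kl) o o'; clear -ik; lia.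
have across i k : i \in ls -> k \in ls -> i < partner B k.
  move=> /eL /andP[ij o] /eL /andP[kl o']; have := paired_lt ij; have := paired_lt kl.
  by have := noncrossing_even (wg_noncrossing gB ij kl) o o'; clear; lia.
have srt : sorted ltn sq.
  rewrite sorted_pairwise; last exact: ltn_trans.
  rewrite pairwise_cat -!sorted_pairwise; try exact: ltn_trans.
  rewrite sorted_lefts rev_sorted; apply/and3P; split=> //.
    apply/allrelP=> x y xl; rewrite mem_rev => /mapP[k kl ->]; exact: across.
  apply: (homo_sorted_in (P := mem ls)) (allss ls) (sorted_lefts B).
  by move=> x y xl yl; apply: nested.
have leN x : x \in sq -> x <= N.
  rewrite mem_cat mem_rev => /orP[/eL/andP[/paired_lt]|/mapP[y /eL/andP[/paired_lt lt _] ->]];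
    lia.
pose f := [ffun k : 'I_(2 * s) => inord (nth 0 sq k) : 'I_N.+1].
have fE : iseq f = sq.
  rewrite /iseq -[RHS](mkseq_nth 0) ssq /mkseq -val_enum_ord -map_comp.
  apply: eq_map => k /=; rewrite ffunE inordK // ltnS leN // mem_nth // ssq.
  exact: ltn_ord.
have nthL k : k < s -> nth 0 sq k = nth 0 ls k by move=> ks; rewrite nth_cat sls ks.
have nthR k : k < s -> nth 0 sq (2 * s - k).-1 = partner B (nth 0 ls k).
  move=> ks; rewrite nth_cat sls ifN; last lia.
  rewrite nth_rev size_map sls; last lia.
  have -> : s - ((2 * s - k).-1 - s).+1 = k by lia.
  by rewrite (nth_map 0) ?sls.
have eK k : k < s -> even_paired B (nth 0 ls k) (partner B (nth 0 ls k)).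
  by move=> ks; apply: eL; rewrite mem_nth ?sls.
apply/existsP; exists f; rewrite /starseq fE -/s srt /=; apply/and3P; split.
- apply/eqP/setP=> P; apply/idP/imsetP => [PB0|[k _ ->]].
    have PB : P \in B by move: PB0; rewrite inE => /andP[].
    have [i [j [ij _ defP]]] := inP_card BP PB.
    have e : even_paired B i j by rewrite /even_paired -mem_B0 -?defP // (paired_lt ij).
    have il : i \in ls by apply/mem_lefts; exists j.
    have ks : index i ls < s by rewrite -sls index_mem.
    exists (Ordinal ks) => //=.
    by rewrite nthR // nthL // nth_index // (partnerE BP ij) setUC.
  rewrite nthR // nthL // setUC; have /andP[p o] := eK k (ltn_ord k).
  by rewrite mem_B0 ?p // (paired_lt p).
- apply/forallP=> k; rewrite nthR // nthL // /wr; have /andP[/paired_lt lt o] := eK k (ltn_ord k).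
  by lia.
apply/forallP=> k; apply/implyP=> /andP[k1 k2]; have k3 := ltn_ord k.
have srtl := sorted_lefts B.
have noB m : m.+1 < s -> forall a b, even_paired B a b -> ~ (nth 0 ls m < a < nth 0 ls m.+1).
  move=> ms a b ab /andP[ma am].
  have al : a \in ls by apply/mem_lefts; exists b.
  have ai : index a ls < s by rewrite -sls index_mem.
  have ea := nth_index 0 al.
  have [lt|[eq|gt]] : index a ls < m \/ index a ls = m \/ m < index a ls by lia.
  - have := @sorted_nth_lt ls (index a ls) m srtl; rewrite ea sls; lia.
  - by move: ma; rewrite -eq ea; lia.
  have [eq|gt'] : index a ls = m.+1 \/ m.+1 < index a ls by lia.
    by move: am; rewrite -eq ea; lia.
  have := @sorted_nth_lt ls m.+1 (index a ls) srtl; rewrite ea sls; lia.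
have [ks|ks] := ltnP k.+1 s.
  rewrite !nthL //; last lia.
  apply: (proj1 (nested_gaps_cov gB bB (eK k _) (eK k.+1 ks) _ (noB k ks))); first lia.
  by apply: sorted_nth_lt => //; rewrite sls; lia.
(* A gap in the second half is the mirror image of the gap after entry m of the first half. *)
pose m := (2 * s - k.+1).-1; have ms : m.+1 < s by lia.
have -> : nth 0 sq k = nth 0 sq (2 * s - m.+1).-1 by congr (nth 0 sq _); lia.
have -> : nth 0 sq k.+1 = nth 0 sq (2 * s - m).-1 by congr (nth 0 sq _); lia.
rewrite !nthR //; last lia.
apply: (proj2 (nested_gaps_cov gB bB (eK m _) (eK m.+1 ms) _ (noB m ms))); first lia.
by apply: sorted_nth_lt => //; rewrite sls; lia.
Qed.

(** * Condition (I), and the completion of a member of X^+ *)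

Lemma even_paired_sB N (B : {set {set 'I_N.+1}}) i j : even_paired B i j -> 0 < sB B.
Proof.
move=> /[dup] e /andP[ij _]; rewrite /sB card_gt0; apply/set0Pn.
by exists [set inord i; inord j]; rewrite mem_B0 ?(paired_lt ij).
Qed.

Lemma sB_even_paired N (B : {set {set 'I_N.+1}}) : inP B -> 0 < sB B ->
  exists i j, even_paired B i j.
Proof.
move=> BP; rewrite /sB card_gt0 => /set0Pn[P PB0].
have PB : P \in B by move: PB0; rewrite inE => /andP[].
have [i [j [ij _ defP]]] := inP_card BP PB; exists i, j.
by rewrite /even_paired -mem_B0 -?defP // (paired_lt ij).
Qed.

Lemma good_between N (B : {set {set 'I_N.+1}}) : good B -> between B.
Proof.
move=> [gB oB] i j k l x ij o kl o' ik xik; have := paired_lt ij; have := paired_lt kl => lkl lij.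
by apply: oB kl o' _ _; lia.
Qed.

Lemma good_star N (B : {set {set 'I_N.+1}}) : good B -> starP B.
Proof. by move=> /[dup] /good_between bB [gB _]; apply: star_intro. Qed.

Lemma barrier0 N (B : {set {set 'I_N.+1}}) : inP B -> barrier B 0.
Proof. by move=> BP k l kl _; left; apply: paired_gt0 BP kl. Qed.

Lemma barrierS N (B : {set {set 'I_N.+1}}) : barrier B N.+1.
Proof. by move=> k l kl _; right; have := paired_lt kl; lia. Qed.

Lemma unmatched_barrier N (B : {set {set 'I_N.+1}}) u : noncrossing_matching B ->
  ~ matched B u -> barrier B u.
Proof.
move=> gB nu k l kl o.
have [uk|[lu|[e|[e|lt]]]] : u < k \/ l < u \/ u = k \/ u = l \/ k < u < l by lia.
- by left.
- by right.
- by case: nu; exists l; left; rewrite e.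
- by case: nu; exists k; right; rewrite e.
by case: nu; apply: wg_inner kl o lt.
Qed.

(** Condition (I) concerns the points outside the outermost even pair ab; points under other even
    arcs but within [a,b] are settled by [between]. Conversely no even pair reaches outside [a,b],
    so the points there are matched by odd pairs. *)
Lemma condI_outer N (B : {set {set 'I_N.+1}}) : starP B -> condI B <-> outer B.
Proof.
move=> stB; have [gB bB out] := star_elim stB; have BP := wg_inP gB.
have cB := noncrossing_closed gB; rewrite /condI.
have [s0|s0] := posnP (sB B); rewrite /=.
  split=> // _ i j x ij o; have := @even_paired_sB N B i j; rewrite /even_paired ij o s0; lia.
have [] := out s0; set a := iS B 1; set b := iS B _ => ab o out'.
have lab := paired_lt ab; have a0 := paired_gt0 BP ab.
have [ba bb] := even_barrier gB (introT andP (conj ab o)).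
split=> [/andP[covL covR]|oB].
  have side x : 0 < x <= N -> x < a \/ b < x -> matched B x.
    move=> xN [xa|bx].
      have aN : a.-1 <= N by lia.
      have [|k [l [kl _ _ _ e]]] := covered0_itv_elim BP cB aN covL (x := x); first lia.
      by have [mk ml] := paired_matched kl; case: e => ->.
    have [|k [l [kl _ _ _ e]]] := covered0_itv_elim BP cB (leqnn N) covR (x := x); first lia.
    by have [mk ml] := paired_matched kl; case: e => ->.
  move=> i j x ij oij xN xij; have [ai jb] := out' _ _ ij oij.
  have [sx|[e|[e|nsx]]] : (x < a \/ b < x) \/ x = a \/ x = b \/ a < x < b by lia.
  - exact: side.
  - by rewrite e; case: (paired_matched ab).
  - by rewrite e; case: (paired_matched ab).
  have nc := noncrossing_even (wg_noncrossing gB ab ij) o oij; have lij := paired_lt ij.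
  by apply: (bB _ _ _ _ _ ab o ij oij); clear -nc lij nsx ai jb xij; lia.
have odd_side k l x : paired B k l -> x < a \/ b < x -> x = k \/ x = l -> odd (k + l).
  move=> kl xs e; case okl: (odd (k + l)) => //.
  by have := out' _ _ kl (negbT okl); have := paired_lt kl; lia.
apply/andP; split.
  apply: (covered0_itv_intro BP cB (barrier0 BP) ba); first lia.
  move=> x xa; split; first by apply: oB ab o _ _; lia.
  by move=> k l kl; apply: odd_side kl _; lia.
have := covered0_itv_intro BP cB bb (@barrierS N B) (leqnn _); apply=> x xb.
split; first by apply: oB ab o _ _; lia.
by move=> k l kl; apply: odd_side kl _; lia.
Qed.

(** * The point u_B *)

(** The interval of an odd pair has an even number of points; the induction splits off the leading
    one. This yields the parity of u_B. *)
Lemma covered0_itv_even N (B : {set {set 'I_N.+1}}) a b : inP B -> closed B -> b <= N ->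
  covered0 B (itv N a b) -> ~~ odd (b.+1 - a).
Proof.
move=> BP cB bN /(covered0_itv_elim BP cB bN).
have [n] := ubnP (b.+1 - a); elim: n a => // n IHn a le cov.
have [ab|ab] := ltnP b a; first by rewrite (_ : b.+1 - a = 0); lia.
have [|k [l [kl o ak lb e]]] := cov a; first lia.
have lkl := paired_lt kl; have eak : a = k by lia.
suff : ~~ odd (b.+1 - l.+1) by subst; lia.
apply: IHn => [|x xb]; first lia.
have [|p [q [pq o' ap qb e']]] := cov x; first lia.
exists p, q; split=> //; have := closed_laminar BP cB kl o pq o'; have := paired_disj BP kl pq.
by have := paired_lt pq; lia.
Qed.

(** The covering intervals avoid u, so each lies on one side of it. *)
Lemma covered1_elim N (B : {set {set 'I_N.+1}}) a b : inP B -> closed B -> 0 < a -> b <= N ->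
  covered1 B (itv N a b) ->
  exists u : 'I_N.+1, [/\ a <= u <= b, covered0 B (itv N a u.-1) & covered0 B (itv N u.+1 b)].
Proof.
move=> BP cB a0 bN /existsP[u /andP[]]; rewrite mem_itv => uab cov; exists u.
have key x : a <= x <= b -> x <> u -> exists k l,
    [/\ paired B k l, odd (k + l), x = k \/ x = l, a <= k /\ l <= b & u < k \/ l < u].
  move=> xab xu; have xX : inord x \in itv N a b :\ u.
    by rewrite in_setD1 mem_itv -val_eqE /= inordK; lia.
  have [k [l [kl o e sub]]] := covered0_elim BP cB cov xX.
  have lt := paired_lt kl; exists k, l; move: e; rewrite inordK; last lia.
  move=> e; have := sub (inord k); have := sub (inord l); have := sub u.
  rewrite !in_setD1 !mem_itv eqxx -!val_eqE /= !inordK; try lia.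
  by move=> h1 h2 h3; split=> //; lia.
split=> //; apply: covered0_intro => // x; rewrite mem_itv => xab.
  have [||k [l [kl o e bd out]]] := key x; try lia.
  exists k, l; split=> // y ykl; rewrite mem_itv; have := paired_lt kl; lia.
have [||k [l [kl o e bd out]]] := key x; try lia.
by exists k, l; split=> // y ykl; rewrite mem_itv; have := paired_lt kl; lia.
Qed.

Lemma covered1_intro N (B : {set {set 'I_N.+1}}) c d u : inP B -> closed B ->
  barrier B c -> barrier B d -> barrier B u -> d <= N.+1 -> c < u < d ->
  (forall x, c < x < d -> x <> u ->
     matched B x /\ forall k l, paired B k l -> x = k \/ x = l -> odd (k + l)) ->
  covered1 B (itv N c.+1 d.-1).
Proof.
move=> BP cB bc bd bu dN ucd h; have uN : u < N.+1 by lia.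
apply/existsP; exists (Ordinal uN); rewrite mem_itv /=; apply/andP; split; first lia.
apply: covered0_intro => // x; rewrite in_setD1 mem_itv -val_eqE /= => /andP[xu xcd].
have [||[y p] ev] := h x; try lia.
have [k [l [kl e]]] : exists k l, paired B k l /\ (x = k :> nat \/ x = l :> nat).
  by case: p => p; [exists x, y | exists y, x]; auto.
exists k, l; have o := ev _ _ kl e; split=> //.
have := bc _ _ kl o; have := bd _ _ kl o; have := bu _ _ kl o.
by move=> h1 h2 h3 z; rewrite in_setD1 mem_itv -val_eqE /=; have := paired_lt kl; lia.
Qed.

Lemma matched_neq N (B : {set {set 'I_N.+1}}) x y : matched B y -> ~ matched B x -> y <> x.
Proof. by move=> my nx e; case: nx; rewrite -e. Qed.

Lemma paired_ltN N (B : {set {set 'I_N.+1}}) k l : ~ matched B N -> paired B k l -> k < l < N.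
Proof.
move=> nN kl; have [_ ml] := paired_matched kl; have := matched_neq ml nN; have := paired_lt kl;
  lia.
Qed.

(** The partner of v would stay between the barriers, hence lie in one of the two covered parts,
    where it already has another partner. *)
Lemma gap_unmatched N (B : {set {set 'I_N.+1}}) c d v : inP B -> closed B ->
  barrier B c -> barrier B d -> d <= N.+1 -> c < v < d ->
  covered0 B (itv N c.+1 v.-1) -> covered0 B (itv N v.+1 d.-1) ->
  (forall k l, paired B k l -> v = k \/ v = l -> odd (k + l)) -> ~ matched B v.
Proof.
move=> BP cB bc bd dN vcd covL covR ev [w p].
have vN : v.-1 <= N by lia.
have dN' : d.-1 <= N by lia.
have no k l x : paired B k l -> v = k \/ v = l -> x = k \/ x = l -> x <> v -> False.
  move=> kl e ex ne; have lkl := paired_lt kl; have o := ev _ _ kl e.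
  have [xv|xv] : c.+1 <= x <= v.-1 \/ v.+1 <= x <= d.-1.
    by have := bc _ _ kl o; have := bd _ _ kl o; lia.
    have [p' [q [pq _ cp qv e']]] := covered0_itv_elim BP cB vN covL xv.
    by have := paired_disj BP kl pq; clear -lkl e ex ne qv cp e' xv; lia.
  have [p' [q [pq _ cp qv e']]] := covered0_itv_elim BP cB dN' covR xv.
  by have := paired_disj BP kl pq; clear -lkl e ex ne qv cp e' xv; lia.
case: p => p; have lt := paired_lt p; last by apply: (no w v w) => //; lia.
by apply: (no v w w) => //; lia.
Qed.

(** Even size of [1,v-1] on the left, or of [v+1,N-1] on the right with N odd, makes the parity of v
    reveal its side. Being the only unmatched point below N outside the outermost even pair, v is
    unique. *)
Lemma ucond_elim N (B : {set {set 'I_N.+1}}) v : odd N -> starP B -> ~ matched B N -> 0 < sB B ->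
  ucond B v ->
  [/\ 0 < v < N, ~ matched B v, odd v = (v < iS B 1), v < iS B 1 \/ iS B (2 * sB B) < v &
      forall x, 0 < x < N -> x < iS B 1 \/ iS B (2 * sB B) < x -> x <> v -> matched B x].
Proof.
move=> oN stB nN s0; have [gB bB out] := star_elim stB; have BP := wg_inP gB.
have cB := noncrossing_closed gB; have [] := out s0; rewrite /ucond /caseI /caseII.
set a := iS B 1; set b := iS B _ => ab o out'.
have lab := paired_lt ab; have a0 := paired_gt0 BP ab.
have /andP[_ bN] := paired_ltN nN ab.
have [ba bb] := even_barrier gB (introT andP (conj ab o)).
have mcov c d x : d <= N -> covered0 B (itv N c d) -> c <= x <= d -> matched B x.
  move=> dN cov xcd; have [k [l [kl _ _ _ e]]] := covered0_itv_elim BP cB dN cov xcd.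
  by have [mk ml] := paired_matched kl; case: e => ->.
have evv k l : paired B k l -> v < a \/ b < v -> v = k \/ v = l -> odd (k + l).
  move=> kl sv e; case okl: (odd (k + l)) => //.
  by have := out' _ _ kl (negbT okl); have := paired_lt kl; move: lab sv e; clear; lia.
have bN' := unmatched_barrier gB nN; have b0 := barrier0 BP.
clearbody a b; clear out out' s0 stB bB.
case/orP=> /and4P[/andP[c1 c2] vab covL covR].
  have va : v < a by lia.
  have vN : v.-1 <= N by lia.
  have aN : a.-1 <= N by lia.
  have NN : N.-1 <= N by lia.
  have ev := covered0_itv_even BP cB vN covL.
  have ov : odd v by move: ev; clear -vab; rewrite prednK; lia.
  split; [lia | | by rewrite va ov | by left |].
    by apply: (gap_unmatched BP cB b0 ba) => //; [by clear -lab; lia | by clear -vab;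
      lia | move=> k l kl; apply: evv kl _; left].
  move=> x xN [xa|bx] xv; last by apply: mcov NN c2 _; lia.
  have [xv'|xv'] : x < v \/ v < x by lia.
    by apply: mcov vN covL _; lia.
  by apply: mcov aN covR _; lia.
have bv : b < v by lia.
have vN : v.-1 <= N by lia.
have aN : a.-1 <= N by lia.
have NN : N.-1 <= N by lia.
have ev := covered0_itv_even BP cB NN covR.
have ov : ~~ odd v by move: ev; clear -oN vab; rewrite prednK; lia.
split; [lia | | | by right |].
  by apply: (gap_unmatched BP cB bb bN') => //; [by clear -vab lab; lia | move=> k l kl;
    apply: evv kl _; right].
  by rewrite (negPf ov); lia.
move=> x xN [xa|bx] xv; first by apply: mcov aN c1 _; lia.
have [xv'|xv'] : x < v \/ v < x by lia.
  by apply: mcov vN covL _; lia.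
by apply: mcov NN covR _; lia.
Qed.

(** Rules out the default value 0 of [uB]. *)
Lemma ucond_exists N (B : {set {set 'I_N.+1}}) : odd N -> starP B -> 0 < sB B ->
  caseI B || caseII B -> ucond B (uB B).
Proof.
move=> oN stB s0 c; have [gB _ out] := star_elim stB; have BP := wg_inP gB.
have cB := noncrossing_closed gB; have [ab _ _] := out s0; have lab := paired_lt ab.
have [u hu] : exists u : 'I_N.+1, ucond B u.
  case/orP: c => /[dup] c; rewrite /ucond => /andP[c1 c2].
    have [//||u [u1 u2 u3]] := covered1_elim BP cB _ _ c1; first by clear -lab; lia.
    by exists u; rewrite c u1 u2 u3.
  have [||u [u1 u2 u3]] := covered1_elim BP cB _ _ c2; try lia.
  by exists u; rewrite c u1 u2 u3 orbT.
by rewrite /uB; case: pickP => [//|/(_ u)]; rewrite hu.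
Qed.

(** * The pair {u_B, N} *)

Definition add_pair N (B : {set {set 'I_N.+1}}) (u : nat) : {set {set 'I_N.+1}} :=
  [set inord u; inord N] |: B.

Lemma paired_add_pair N (B : {set {set 'I_N.+1}}) u i j : u < N ->
  paired (add_pair B u) i j <-> paired B i j \/ (i = u /\ j = N).
Proof.
move=> uN; rewrite /paired in_setU1; split.
  case/and3P=> ij jN /orP[/eqP e|->]; last by left; rewrite ij jN.
  by right; apply: set2_inord_inj e; rewrite ?ij ?jN // uN leqnn.
case=> [/and3P[-> -> ->]|[-> ->]]; first by rewrite orbT.
by rewrite uN leqnn eqxx.
Qed.

Lemma matched_add_pair N (B : {set {set 'I_N.+1}}) u x : u < N -> matched B x ->
  matched (add_pair B u) x.
Proof. by move=> uN [y p]; exists y; rewrite !paired_add_pair //; case: p; auto. Qed.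

Lemma mem_epsbaseU1 N (B : {set {set 'I_N.+1}}) P x : P \notin B ->
  (x \in epsbase (P |: B)) = (x \in dbr P) (+) (x \in epsbase B).
Proof.
move=> nP; rewrite !mem_epsbase; have [xP|xP] := boolP (x \in dbr P).
  have -> : [set Q in P |: B | x \in dbr Q] = P |: [set Q in B | x \in dbr Q].
    apply/setP=> Q; rewrite in_set in_setU1 in_setU1 in_set.
    by case: (Q =P P) => [->|//]; rewrite xP.
  by rewrite cardsU1 in_set (negPf nP).
rewrite addFb; congr (odd _); apply: eq_card => Q; rewrite in_set in_setU1 in_set.
by case: (Q =P P) => [->|//]; rewrite (negPf xP) !andbF.
Qed.

Lemma sB_setU1 N (B : {set {set 'I_N.+1}}) P : P \notin B ->
  sB (P |: B) = (P \in B0 (P |: B)) + sB B.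
Proof.
move=> nP; rewrite /sB; have [eP|eP] := boolP (P \in B0 (P |: B)).
  have -> : B0 (P |: B) = P |: B0 B.
    apply/setP=> Q; rewrite in_setU1; case: (Q =P P) => [-> //|/eqP ne].
    by rewrite ![_ \in B0 _]in_set in_setU1 (negPf ne).
  by rewrite cardsU1 [_ \in B0 _]in_set (negPf nP).
rewrite add0n; apply: eq_card => Q; case: (Q =P P) => [->|/eqP ne].
  by rewrite (negPf eP) [_ \in B0 _]in_set (negPf nP).
by rewrite ![_ \in B0 _]in_set in_setU1 (negPf ne).
Qed.

Lemma add_pair_new N (B : {set {set 'I_N.+1}}) u : u < N -> ~ matched B N ->
  [set inord u; inord N] \notin B.
Proof. by move=> uN nN; apply/negP=> h; apply: nN; exists u; right; rewrite /paired uN leqnn. Qed.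

Lemma sB_add_pair N (B : {set {set 'I_N.+1}}) u : odd N -> u < N -> ~ matched B N ->
  sB (add_pair B u) = odd u + sB B.
Proof.
move=> oN uN nN; rewrite sB_setU1; last exact: add_pair_new.
have lt : u < N <= N by rewrite uN leqnn.
rewrite (mem_B0 _ lt); have -> : paired (add_pair B u) u N by apply/paired_add_pair => //; right.
by rewrite oddD oN /= addbT negbK.
Qed.

Lemma add_pair_inP N (B : {set {set 'I_N.+1}}) u : inP B -> 0 < u < N -> ~ matched B u ->
  ~ matched B N ->
  inP (add_pair B u).
Proof.
move=> BP uN nu nN; have lt : u < N <= N by lia.
set P : {set 'I_N.+1} := [set inord u; inord N].
have dj Q : Q \in B -> [disjoint P & Q].
  move=> QB; have [k [l [kl k0 ->]]] := inP_card BP QB; have lkl := paired_lt kl.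
  have [mk ml] := paired_matched kl.
  apply/pred0P=> x /=; rewrite !mem_inord2; try lia; apply/negbTE/negP=> /andP[h1 h2].
  have := matched_neq mk nu; have := matched_neq ml nu; have := matched_neq mk nN;
    have := matched_neq ml nN; lia.
apply/andP; split; apply/forallP=> Q; apply/implyP; rewrite in_setU1 => /orP[/eqP->|QB].
- rewrite cards2 inord_eq; try lia.
  rewrite (_ : u != N) //=; last lia.
  by apply/forallP=> x; apply/implyP; rewrite mem_inord2; lia.
- by case/andP: BP => /forallP/(_ Q); rewrite QB.
- apply/forallP=> R; apply/implyP; rewrite in_setU1 => /orP[/eqP->|RB]; first by rewrite eqxx.
  by apply/implyP=> _; apply: dj.
apply/forallP=> R; apply/implyP; rewrite in_setU1 => /orP[/eqP->|RB].
  by apply/implyP=> _; rewrite disjoint_sym; apply: dj.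
by case/andP: BP => _ /forallP/(_ Q); rewrite QB => /forallP/(_ R); rewrite RB.
Qed.

(** If v is left of all even pairs, it is odd and the new even pair encloses them; if v is right of
    them, it is even and the new odd pair lies beside them. Either way the last unmatched points
    outside the even pairs, v and N, are used up. *)
Lemma add_pair_good N (B : {set {set 'I_N.+1}}) v : odd N -> starP B -> ~ matched B N ->
  0 < sB B ->
  ucond B v -> good (add_pair B v).
Proof.
move=> oN stB nN s0 uc; have [vN nv ov side cov] := ucond_elim oN stB nN s0 uc.
have [gB bB out] := star_elim stB; have BP := wg_inP gB; have := out s0.
set a := iS B 1 in ov side cov *; set b := iS B _ in side cov * => -[ab o out'].
have lab := paired_lt ab; have a0 := paired_gt0 BP ab.
have /andP[_ bN] := paired_ltN nN ab.
have vlt : v < N by lia.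
have bv := unmatched_barrier gB nv.
have ltN k l : paired B k l -> k < l < N by apply: paired_ltN.
have nvN : matched (add_pair B v) v /\ matched (add_pair B v) N.
  by apply: (@paired_matched N (add_pair B v)); apply/paired_add_pair => //; right.
have [ma mb] := paired_matched ab; have vab : a <> v /\ b <> v by split; apply: matched_neq nv.
have new k l : paired B k l -> noncrossing k l v N.
  move=> kl; have := ltN _ _ kl; rewrite /noncrossing; case okl: (odd (k + l)).
    by have := bv _ _ kl okl; clear -vlt; lia.
  by have := out' _ _ kl (negbT okl); clear -vlt side vN oN ov okl; lia.
split; first split.
- by apply: add_pair_inP => //; lia.
- move=> i j k l /paired_add_pair-/(_ vlt)[ij|[-> ->]] /paired_add_pair-/(_ vlt)[kl|[-> ->]].
  + exact: wg_noncrossing gB _ _ _ _ ij kl.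
  + exact: new.
  + exact: noncrossing_sym (new _ _ kl).
  by left.
- move=> i j x /paired_add_pair-/(_ vlt)[ij|[-> ->]] oij xij; apply: matched_add_pair => //.
    exact (wg_inner gB ij oij xij).
  by apply: cov; lia.
have base x : 0 < x <= N -> x < a \/ b < x -> matched (add_pair B v) x.
  move=> xN xs; have [->|[->|[xv xN']]] : x = v \/ x = N \/ (x <> v /\ x < N) by lia.
  - exact: nvN.1.
  - exact: nvN.2.
  by apply: matched_add_pair => //; apply: cov => //; lia.
move=> i j x /paired_add_pair-/(_ vlt)[ij|[-> ->]] oij xN xij; last by apply: base; lia.
have [ai jb] := out' _ _ ij oij.
have [sx|[e|[e|nsx]]] : (x < a \/ b < x) \/ x = a \/ x = b \/ a < x < b by lia.
- exact: base.
- by rewrite e; apply: matched_add_pair => //; case: (paired_matched ab).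
- by rewrite e; apply: matched_add_pair => //; case: (paired_matched ab).
apply: matched_add_pair => //; have nc := noncrossing_even (wg_noncrossing gB ab ij) o oij;
  have lij := paired_lt ij.
by apply: (bB _ _ _ _ _ ab o ij oij); clear -nc lij nsx ai jb xij; lia.
Qed.

(** * Membership of N and the two halves *)

Lemma ord_max_inord N : ord_max = inord N :> 'I_N.+1.
Proof. by apply: val_inj; rewrite /= inordK. Qed.

Lemma paired_N_false N (B : {set {set 'I_N.+1}}) y : ~ paired B N y.
Proof. by move=> p; have := paired_lt p; lia. Qed.

(** Gap N has depth |B^0|. If u is odd, N opens an even arc and b(N) is the parity of |B^0|; if u is
    even, N closes an odd arc and b(N) is the parity of |B^0| + 1. *)
Lemma N_epsbase N (B : {set {set 'I_N.+1}}) : odd N -> good B ->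
  (inord N \in epsbase B) <-> exists2 u, paired B u N & odd u = odd (sB B).
Proof.
move=> oN gB; have BP := wg_inP gB.1.
have N0 : 0 < N <= N by rewrite leqnn andbT; case: (N) oN.
have key u : paired B u N -> (inord N \in epsbase B) = (odd u == odd (sB B)).
  move=> uN; case ou: (odd u).
    have op : opener B N by exists u; right; rewrite oddD ou oN.
    by have [_ ->] := opener_depth BP op; rewrite depthN //; case: (odd _).
  have cl : closer B N by exists u; left; rewrite oddD ou oN.
  by have [-> ->] := closer_depth BP cl; rewrite depthN //= ; case: (odd _).
split=> [NX|[u /key -> ->]]; last by rewrite eqxx.
have [[y [/paired_N_false//|yN]]|nN] := matched_dec BP (leqnn N).
  by exists y => //; apply/eqP; rewrite -key.
by have [_ _] := unmatched_depth gB N0 nN; rewrite NX.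
Qed.

Lemma hasNpairP N (B : {set {set 'I_N.+1}}) p : inP B ->
  hasNpair B p <-> exists2 u, paired B u N & odd u = p.
Proof.
move=> BP; split=> [/existsP[i /andP[/eqP <- iB]]|[u uN <-]].
  exists i => //; rewrite /paired inord_val -ord_max_inord iB leqnn !andbT.
  have [k [l [/paired_lt kl _ e]]] := inP_card BP iB.
  have := ltn_ord i; rewrite ltnS leq_eqVlt => /orP[/eqP ei|//].
  have : #|[set i; ord_max]| = 2 by rewrite e cards2 inord_eq; lia.
  by rewrite cards2 -val_eqE /= ei eqxx.
have /andP[lt _] := paired_lt uN; apply/existsP; exists (inord u).
rewrite inordK; last lia.
by rewrite eqxx ord_max_inord; case/and3P: uN.
Qed.

Lemma Xm_good N (B : {set {set 'I_N.+1}}) : odd N ->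
  inXm B <-> good B /\ ord_max \in epsbase B.
Proof.
move=> oN; rewrite ord_max_inord.
have pair : inP B -> (if odd (sB B) then hasNpair B true else hasNpair B false) <->
    exists2 u, paired B u N & odd u = odd (sB B).
  by move=> BP; case: (odd (sB B)); exact: hasNpairP.
split=> [/andP[stB /andP[cI hN]]|[gB NX]].
  have [gB _ _] := star_elim stB; have oB := (condI_outer stB).1 cI.
  by split=> //; apply/N_epsbase => //; apply/pair => //; apply: wg_inP gB.
have stB := good_star gB; apply/andP; split=> //; apply/andP; split.
  by apply/(condI_outer stB); case: gB.
by apply/pair; [apply: wg_inP gB.1 | apply/N_epsbase].
Qed.

Lemma inP_sub N (B B' : {set {set 'I_N.+1}}) : B \subset B' -> inP B' -> inP B.
Proof.
move=> /subsetP sub /andP[/forallP h1 /forallP h2]; apply/andP; split.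
  by apply/forallP=> P; apply/implyP=> /sub PB; have := h1 P; rewrite PB.
apply/forallP=> P; apply/implyP=> /sub PB; apply/forallP=> Q; apply/implyP=> /sub QB.
by have := h2 P; rewrite PB => /forallP/(_ Q); rewrite QB.
Qed.

Definition completion N (B : {set {set 'I_N.+1}}) : {set {set 'I_N.+1}} :=
  if sB B == 0 then B else add_pair B (uB B).

Lemma Xp_elim N (B : {set {set 'I_N.+1}}) : odd N -> inXp B -> 0 < sB B ->
  [/\ starP B, ~ matched B N, odd (sB B) & ucond B (uB B)].
Proof.
move=> oN /andP[stB /andP[nN]] /orP[/eqP-> //|/andP[os c]] s0.
have [gB _ _] := star_elim stB; split=> //; last exact: ucond_exists.
by move: nN; rewrite ord_max_inord => /(suppP (wg_inP gB) (leqnn N)).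
Qed.

Lemma Xp_unmatched N (B : {set {set 'I_N.+1}}) : inXp B -> ~ matched B N.
Proof.
move=> /andP[stB /andP[nN _]]; have [gB _ _] := star_elim stB.
by move: nN; rewrite ord_max_inord => /(suppP (wg_inP gB) (leqnn N)).
Qed.

(** The correction term in [eps] is the set [[ ]] of the pair {u_B, N}: [u_B,N] for even u_B, and
    {N} + [1,u_B] for odd u_B. *)
Lemma eps_add_pair N (B : {set {set 'I_N.+1}}) : odd N -> inXp B -> 0 < sB B ->
  eps B = epsbase (add_pair B (uB B)).
Proof.
move=> oN XB s0; have [stB nN os uc] := Xp_elim oN XB s0.
have [uN nu _ _ _] := ucond_elim oN stB nN s0 uc; have [gB _ _] := star_elim stB.
have BP := wg_inP gB; have gB' := add_pair_good oN stB nN s0 uc.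
have nXm : ~~ inXm B.
  apply/negP=> /andP[_ /andP[_]]; rewrite os => /(hasNpairP _ BP)[u p _].
  by apply: nN; exists u; right.
rewrite /eps (negPf nXm) orbF eqn0Ngt s0 /=; set u := uB B in uN nu *.
have uN' : u < N by case/andP: uN.
have lt : u < N <= N by rewrite uN' leqnn.
have u0 : 0 < u by case/andP: uN.
have new := add_pair_new uN' nN.
(* The spare ordinal 0 is in neither set and is treated apart, since [dbrE] concerns positive
   points. *)
apply/setP=> x; have [x0|x0] := posnP x.
  have nS Y : inS Y -> (x \in Y) = false.
    by move/forallP/(_ x)/implyP => h; apply/negP=> /h; rewrite x0.
  have e1 := nS _ (epsbase_inS BP); have e2 := nS _ (epsbase_inS (wg_inP gB'.1)).
  by rewrite e2; case: ifP => _; rewrite !in_symd ?in_set1 e1 mem_itv -?val_eqE /= x0;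
    clear -u0 lt; lia.
have xN : 0 < x <= N by rewrite x0 -ltnS ltn_ord.
have dx := dbrE u0 lt xN; rewrite inord_val in dx.
rewrite mem_epsbaseU1 // dx addbC oddD oN addbT.
case: ifP => ou /=; rewrite !in_symd ?in_set1 mem_itv -?val_eqE /=.
  rewrite -addbA; congr (_ (+) _); move: uN' u0 xN; clear; lia.
congr (_ (+) _); move: xN; clear; lia.
Qed.

(** As |B^0| is odd, the new pair makes the number of even pairs opposite in parity to u_B, so N
    stays out of the set. Recovery of B by deletion of the pair at N gives injectivity. *)
Lemma Xp_completion N (B : {set {set 'I_N.+1}}) : odd N -> inXp B ->
  [/\ good (completion B), eps B = epsbase (completion B),
      ord_max \notin epsbase (completion B),
      sB (completion B) = (if sB B == 0 then 0 else odd (uB B) + sB B) &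
      sB B = 0 \/ odd (sB B)] /\
  B = [set P in completion B | ord_max \notin P].
Proof.
move=> oN XB; rewrite /completion; have nN := Xp_unmatched XB.
have stB : starP B by case/andP: XB.
have [gB _ _] := star_elim stB; have BP := wg_inP gB.
have noN P : P \in B -> ord_max \notin P.
  move=> PB; have [k [l [kl _ ->]]] := inP_card BP PB; have lt := paired_ltN nN kl.
  rewrite ord_max_inord mem_inord2; try lia.
  by rewrite inordK //; lia.
have eB : B = [set P in B | ord_max \notin P].
  by apply/setP=> P; rewrite in_set; case: (boolP (P \in B)) => // /noN ->.
have [s0|s0] := posnP (sB B).
  have gB' : good B.
    split=> // i j x ij o; have := @even_paired_sB N B i j;
      rewrite /even_paired ij o s0 => /(_ isT).
    by [].
  split=> //; split=> //; rewrite ?s0 //; [by rewrite /eps s0| |by left].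
  rewrite ord_max_inord; apply/negP=> /(N_epsbase oN gB')[u p _].
  by apply: nN; exists u; right.
rewrite /=; have [_ _ os uc] := Xp_elim oN XB s0.
have [uN nu _ _ _] := ucond_elim oN stB nN s0 uc.
have uN' : uB B < N by case/andP: uN.
have gB' := add_pair_good oN stB nN s0 uc.
split; first split=> //.
- exact: eps_add_pair.
- rewrite ord_max_inord; apply/negP=> /(N_epsbase oN gB')[u p].
  have p' : paired (add_pair B (uB B)) (uB B) N by apply/paired_add_pair => //; right.
  have [[-> _]|] := paired_disj (wg_inP gB'.1) p p'; last by case=> _ [_ [_]].
  by rewrite sB_add_pair // oddD os; case: (odd (uB B)).
- exact: sB_add_pair.
- by right.
apply/setP=> P; rewrite in_set in_setU1; case: eqP => [->|_] /=.
  rewrite mem_inord2 ?(ltnW uN') //= eqxx orbT /=.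
  by apply/negbTE/add_pair_new.
by rewrite {1}eB in_set.
Qed.

Lemma side_cov N (B : {set {set 'I_N.+1}}) a b u : noncrossing_matching B -> even_paired B a b ->
  ~ matched B N -> ~ matched B u -> 0 < u < N -> u < a \/ b < u ->
  (forall x, 0 < x < N -> x < a \/ b < x -> x <> u ->
    matched B x /\ forall k l, paired B k l -> x = k \/ x = l -> odd (k + l)) ->
  (covered1 B (itv N 1 a.-1) && covered0 B (itv N b.+1 N.-1)) ||
  (covered0 B (itv N 1 a.-1) && covered1 B (itv N b.+1 N.-1)).
Proof.
move=> gB ab nN nu uN side cover; have BP := wg_inP gB; have cB := noncrossing_closed gB.
have [ba bb] := even_barrier gB ab; have bu := unmatched_barrier gB nu.
have bN := unmatched_barrier gB nN; have b0 := barrier0 BP.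
have /andP[_ abN] := paired_ltN nN (proj1 (andP ab)); have aN := paired_lt (proj1 (andP ab)).
case: side => su; apply/orP; [left | right]; apply/andP; split.
- apply: (covered1_intro BP cB b0 ba bu); [lia | lia |].
  by move=> x xa xu; apply: cover => //; lia.
- apply: (covered0_itv_intro BP cB bb bN); first lia.
  by move=> x xa; apply: cover => //; lia.
- apply: (covered0_itv_intro BP cB b0 ba); first lia.
  by move=> x xa; apply: cover => //; lia.
apply: (covered1_intro BP cB bb bN bu); [lia | lia |].
by move=> x xa xu; apply: cover => //; lia.
Qed.

(** The inverse deletes the pair {u, N}. If even pairs exist, N is matched by [outer]; N outside the
    set means that u and their number differ in parity, so an odd number of even pairs remains. *)
Lemma Xp_surj N (B' : {set {set 'I_N.+1}}) : odd N -> good B' -> ord_max \notin epsbase B' ->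
  exists2 B, inXp B & completion B = B'.
Proof.
move=> oN gB'; rewrite ord_max_inord => NX; have BP' := wg_inP gB'.1.
have [s0|s0] := posnP (sB B').
  have nN : ~ matched B' N.
    (* Without even pairs a partner y of N would be even, and N would lie in the set. *)
    case=> y [/paired_N_false//|yN]; move/negP: NX; apply; apply/N_epsbase => //.
    exists y => //; rewrite s0; case oy: (odd y) => //.
    by have := @even_paired_sB N B' y N; rewrite /even_paired yN oddD oy oN s0 => /(_ isT).
  exists B'; last by rewrite /completion s0.
  rewrite /inXp good_star //= /condII s0 eqxx /= andbT ord_max_inord.
  by apply/negP=> /(suppP BP' (leqnn N)).
have [u uN] : exists u, paired B' u N.
  have [i [j /andP[ij o]]] := sB_even_paired BP' s0.
  have [[y [/paired_N_false//|yN]]|nN] := matched_dec BP' (leqnn N); first by exists y.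
  by case: (nN); apply: (gB'.2 i j) => //; have := paired_ltN nN ij; lia.
have ous : odd u <> odd (sB B') by move=> e; move/negP: NX; apply; apply/N_epsbase => //;
  exists u.
have lt := paired_lt uN; have u0 := paired_gt0 BP' uN; have uN' : u < N by lia.
pose P : {set 'I_N.+1} := [set inord u; inord N]; pose B := B' :\ P.
have addB : add_pair B u = B' by apply: setD1K; case/and3P: uN.
have prB i j : paired B i j <-> paired B' i j /\ j <> N.
  split=> [/and3P[ij jN /setD1P[ne iB]]|[/and3P[ij jN iB] ne]].
    have p : paired B' i j by rewrite /paired ij jN.
    split=> // jN'; move: ne.
    have [[-> ->]|] := paired_disj BP' p uN; last by case=> _ [_ [_]].
    by rewrite eqxx.
  rewrite /paired ij jN in_setD1 iB andbT; apply/eqP=> /set2_inord_inj[]; try lia.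
have BP : inP B by apply: inP_sub BP'; apply: subD1set.
have nN : ~ matched B N by case=> y [/paired_N_false//|/prB[_]].
have nu : ~ matched B u.
  case=> y [] /prB[p ne]; have := paired_disj BP' p uN; lia.
have mtB x : matched B' x -> x <> u -> x <> N -> matched B x.
  move=> [y p] xu xN; exists y; rewrite !prB; case: p => p; [left | right]; split=> //.
  by have := paired_disj BP' p uN; lia.
have ncu i j : paired B i j -> noncrossing i j u N /\ i < j < N.
  by move=> /[dup] /(paired_ltN nN) l /prB[p _]; split=> //;
    apply: wg_noncrossing gB'.1 _ _ _ _ p uN.
have gB : noncrossing_matching B.
  split=> // [i j k l /prB[ij _] /prB[kl _]|i j x ij o xij].
    exact: wg_noncrossing gB'.1 _ _ _ _ ij kl.
  have [nc l] := ncu _ _ ij; apply: mtB; [|move: nc; rewrite /noncrossing; lia|lia].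
  have [ij' _] := (prB i j).1 ij; exact (wg_inner gB'.1 ij' o xij).
have bB : between B.
  move=> i j k l x ij o kl o' ik xik; have [nc lij] := ncu _ _ ij; have [nc' lkl] := ncu _ _ kl.
  have [ij' _] := (prB i j).1 ij; have [kl' _] := (prB k l).1 kl.
  apply: mtB; [exact (good_between gB' ij' o kl' o' ik xik)| |].
    have nk := wg_noncrossing gB ij kl.
    by move: nc nc' nk lij lkl xik ik o o'; clear; rewrite /noncrossing; lia.
  by move: xik lij lkl; clear; lia.
have stB := star_intro gB bB.
have sE : sB B' = odd u + sB B by rewrite -addB sB_add_pair.
have os : odd (sB B) by move: ous; rewrite sE oddD oddb; case: (odd u); case: (odd _).
have sB0 : 0 < sB B by case: (sB B) os.
have [_ _ out] := star_elim stB; have := out sB0.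
case=> ab o out'; have [nab lab] := ncu _ _ ab; have [ab' _] := (prB _ _).1 ab.
have a0 := paired_gt0 BP ab.
have side : u < iS B 1 \/ iS B (2 * sB B) < u by move: nab lab; clear; rewrite /noncrossing; lia.
clear nab ncu ous lt sE s0.
have cover x : 0 < x < N -> x < iS B 1 \/ iS B (2 * sB B) < x -> x <> u ->
    matched B x /\ forall k l, paired B k l -> x = k \/ x = l -> odd (k + l).
  move=> xN xab xu; split.
    apply: mtB => //; last by clear -xN; lia.
    by apply: (gB'.2 _ _ _ ab' o _ xab); clear -xN; lia.
  move=> k l kl e; case okl: (odd (k + l)) => //.
  have := out' _ _ kl (negbT okl); have := paired_lt kl; move: xab e lab; clear; lia.
have u0N : 0 < u < N by rewrite u0.
have cases : caseI B || caseII B := side_cov gB (introT andP (conj ab o)) nN nu u0N side cover.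
have XB : inXp B.
  rewrite /inXp stB /condII os cases orbT andbT ord_max_inord.
  by apply/negP=> /(suppP BP (leqnn N)).
exists B => //; rewrite /completion eqn0Ngt sB0 /=.
have uc := ucond_exists oN stB sB0 cases.
have [vN nv _ vside _] := ucond_elim oN stB nN sB0 uc.
(* After the deletion u is the only unmatched point available to [uB]. *)
have -> // : uB B = u.
have [//|/eqP ne] := eqVneq (uB B) u.
by case: nv; apply: (proj1 (cover _ _ vside ne)).
Qed.

(** * The bijections and their refinement by gamma *)

Lemma bijOn_sub (T U : Type) (A A' : T -> bool) (E E' : U -> bool) (f : T -> U) :
  bijOn A E f -> (forall x, A x -> A' x = E' (f x)) ->
  bijOn (fun x => A x && A' x) (fun z => E z && E' z) f.
Proof.
move=> [fE finj fsurj] h; split.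
- by move=> x /andP[Ax A'x]; rewrite fE // -h.
- by move=> x y /andP[Ax _] /andP[Ay _]; apply: finj.
move=> z /andP[Ez E'z]; have [x Ax fx] := fsurj z Ez.
by exists x => //; rewrite Ax h // fx.
Qed.

Lemma bij_Xp N : odd N -> bijOn (@inXp N) (@inEp N) (@eps N).
Proof.
move=> oN; split=> [B /(Xp_completion oN)[[gB -> NX _ _] _]|B1 B2 X1 X2 e|X /andP[XE NX]].
- by rewrite /inEp good_inE.
- have [[g1 e1 _ _ _] ->] := Xp_completion oN X1.
  have [[g2 e2 _ _ _] ->] := Xp_completion oN X2.
  suff -> : completion B1 = completion B2 by [].
  exact (epsbase_inj oN g1 g2 (etrans (esym e1) (etrans e e2))).
have [B' gB' eB'] := epsbase_surj oN XE.
have [|B XB cB] := Xp_surj oN gB'; first by rewrite eB'.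
by exists B => //; have [[_ -> _ _ _] _] := Xp_completion oN XB; rewrite cB.
Qed.

Lemma eps_Xm N (B : {set {set 'I_N.+1}}) : inXm B -> eps B = epsbase B.
Proof. by move=> XB; rewrite /eps XB orbT. Qed.

Lemma bij_Xm N : odd N -> bijOn (@inXm N) (@inEm N) (@eps N).
Proof.
move=> oN; split=> [B XB|B1 B2 X1 X2|X /andP[XE NX]].
- by have [gB NX] := (Xm_good _ oN).1 XB; rewrite eps_Xm // /inEm good_inE.
- rewrite !eps_Xm //; have [g1 _] := (Xm_good _ oN).1 X1; have [g2 _] := (Xm_good _ oN).1 X2.
  exact: epsbase_inj.
have [B gB eB] := epsbase_surj oN XE; have XB : inXm B by apply/Xm_good; rewrite // eB.
by exists B; rewrite // eps_Xm.
Qed.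

(** For s = |B^0| odd, the completion has s + 1 even pairs if u_B is odd and s if it is even; twice
    [psi] is then s + 1, respectively -(s + 1). *)
Lemma Xtp_gamma N (B : {set {set 'I_N.+1}}) (t : int) : odd N -> ~~ odd (absz t) -> inXp B ->
  (if t == 0%R then sB B == 0
   else if (0 < t)%R then (sB B == (absz t).-1) && odd (uB B)
   else (sB B == (absz t).-1) && ~~ odd (uB B)) = (gamma (eps B) == t).
Proof.
move=> oN et XB; have [[gB -> _ sc os] _] := Xp_completion oN XB.
rewrite good_gamma // sc /psi; move: (sB B) (uB B) os => s u [->|os] /=.
  by case: (t =P 0%R) => t0; [rewrite t0 | case: ifP; lia].
have -> : (s == 0) = false by apply/negbTE; rewrite -lt0n; case: (s) os.
case ou: (odd u); rewrite /= os /=; by case: (t =P 0%R) => t0; [lia | case: ifP; lia].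
Qed.

(** Twice psi(s) is s for even s and -(s + 1) for odd s; by (III) the partner of N has the parity of
    s, so the condition on it selects the sign. *)
Lemma Xtm_gamma N (B : {set {set 'I_N.+1}}) (t : int) : odd N -> ~~ odd (absz t) -> inXm B ->
  (if t == 0%R then sB B == 0
   else if (0 < t)%R then (sB B == absz t) && hasNpair B false
   else (sB B == (absz t).-1) && hasNpair B true) = (gamma (eps B) == t).
Proof.
move=> oN et XB; have [gB _] := (Xm_good _ oN).1 XB.
rewrite eps_Xm // good_gamma //; case/andP: XB => _ /andP[_ hN].
have BP := wg_inP gB.1.
have hN' : hasNpair B (odd (sB B)) by case: (odd _) hN.
have nhN : hasNpair B (~~ odd (sB B)) = false.
  apply: negbTE; apply/negP=> h; have [u p ou] := (hasNpairP _ BP).1 h;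
    have [v p' ov] := (hasNpairP _ BP).1 hN'.
  have [[e _]|] := paired_disj BP p p'; last by case=> _ [_ [_]].
  by move: ou; rewrite e ov; case: (odd _).
rewrite /psi; case os: (odd (sB B)) hN' nhN => /= -> ->; rewrite ?andbT ?andbF.
  by case: (t =P 0%R) => t0; [lia | case: ifP; lia].
by case: (t =P 0%R) => t0; [lia | case: ifP; lia].
Qed.

Theorem theorem2p13 (N : nat) :
  3 <= N -> odd N ->
  [/\ bijOn (@inXp N) (@inEp N) (@eps N),
      bijOn (@inXm N) (@inEm N) (@eps N) &
      forall t : int, ~~ odd (absz t) ->
        bijOn (@Xtp N t) (@Etp N t) (@eps N) /\
        bijOn (@Xtm N t) (@Etm N t) (@eps N)].
Proof.
move=> _ oN; split; [exact: bij_Xp | exact: bij_Xm |].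
move=> t et; split.
  apply: bijOn_sub (bij_Xp oN) _ => B; exact: Xtp_gamma.
apply: bijOn_sub (bij_Xm oN) _ => B; exact: Xtm_gamma.
Qed.
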